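(* Let $k$ be a field with at least $8$ elements. Every algebraic group over $k$ (not necessarily smooth) is isomorphic to $\underline{\mathrm{Aut}}(A)$ for some finite-dimensional algebra $A$ over $k$.
   Context: An algebraic group over $k$ is an affine group scheme of finite type over $k$. An algebra $A$ over $k$ is a $k$-vector space $V$ equipped with a $k$-linear map $t\colon V\otimes_k V\to V$, with no further conditions (not necessarily associative, commutative or unital). A commutative $k$-algebra is a commutative associative $k$-algebra with identity. For a finite-dimensional algebra $A=(V,t)$, $\underline{\mathrm{Aut}}(A)$ is the algebraic subgroup of $\mathrm{GL}_V$ representing the functor $R\mapsto \mathrm{Aut}_R(R\otimes_k A)$ ($R$-linear algebra automorphisms) on commutative $k$-algebras $R$. *)

(* Defs.v *)
From HB Require Import structures.
From mathcomp Require Import all_boot all_order all_algebra.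
From mathcomp Require Import boolp.

Set Implicit Arguments.
Unset Strict Implicit.
Unset Printing Implicit Defensive.
Import GRing.Theory.
Local Open Scope ring_scope.

(* A commutative k-algebra is a commutative ring with a structure morphism     *)
(* from k. MathComp's comAlgType is not used because it excludes the zero      *)
(* algebra.                                                                    *)
Record comAlg (k : fieldType) := ComAlg {
  ca_ring :> comPzRingType;
  ca_in : {rmorphism k -> ca_ring}
}.

Record algHom (k : fieldType) (R S : comAlg k) := AlgHom {
  ah_fun :> {rmorphism R -> S};
  ah_in : forall c : k, ah_fun (ca_in R c) = ca_in S c
}.

Lemma algHomP (k : fieldType) (R S : comAlg k) (f g : algHom R S) :
  f =1 g -> f = g.
Proof.
case: f g => [f fP] [g gP] /= fg.
have e : f = g.
  case: f g fg {fP gP} => [f [[a] [b]]] [g [[a'] [b']]] /= fg.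
  have e : f = g by apply: funext.
  by subst g; rewrite (Prop_irrelevance a a') (Prop_irrelevance b b').
by subst g; rewrite (Prop_irrelevance fP gP).
Qed.

Definition algHom_id (k : fieldType) (R : comAlg k) : algHom R R :=
  @AlgHom k R R (idfun : {rmorphism R -> R}) (fun _ => erefl).

Definition algHom_comp (k : fieldType) (R S T : comAlg k)
    (g : algHom S T) (f : algHom R S) : algHom R T :=
  @AlgHom k R T (g \o f : {rmorphism R -> T})
    (fun c => etrans (congr1 g (ah_in f c)) (ah_in g c)).

Record groupFunctor (k : fieldType) := GroupFunctor {
  gf_obj :> comAlg k -> groupType;
  gf_map : forall R S : comAlg k, algHom R S -> gf_obj R -> gf_obj S;
  gf_mapM : forall (R S : comAlg k) (f : algHom R S),
    {morph gf_map f : x y / (x * y)%g};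
  gf_map_id : forall (R : comAlg k) (x : gf_obj R),
    gf_map (algHom_id R) x = x;
  gf_map_comp : forall (R S T : comAlg k) (g : algHom S T) (f : algHom R S)
    (x : gf_obj R), gf_map (algHom_comp g f) x = gf_map g (gf_map f x)
}.

(* The smallest subalgebra of H containing the list s is H itself.             *)
Definition finitely_generated (k : fieldType) (H : comAlg k) : Prop :=
  exists s : seq H, forall P : H -> Prop,
    (forall c : k, P (ca_in H c)) ->
    (forall x, x \in s -> P x) ->
    (forall x y, P x -> P y -> P (x + y)) ->
    (forall x y, P x -> P y -> P (x * y)) ->
    forall x, P x.

(* By the Yoneda lemma, u is the same as an isomorphism Hom(H, -) -> G.        *)
Definition represents (k : fieldType) (G : groupFunctor k)
    (H : comAlg k) (u : G H) : Prop :=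
  forall R : comAlg k, bijective (fun f : algHom H R => gf_map f u).

(* Affine group schemes of finite type, as functors of points.                 *)
Record algebraicGroup (k : fieldType) := AlgebraicGroup {
  ag_functor :> groupFunctor k;
  ag_representable : exists (H : comAlg k) (u : ag_functor H),
    finitely_generated H /\ represents u
}.

Definition gf_isomorphic (k : fieldType) (G G' : groupFunctor k) : Prop :=
  exists phi : forall R : comAlg k, G R -> G' R,
    [/\ forall R : comAlg k, bijective (phi R),
        forall R : comAlg k, {morph phi R : x y / (x * y)%g} &
        forall (R S : comAlg k) (f : algHom R S) (x : G R),
          phi S (gf_map f x) = gf_map f (phi R x)].

Record fdAlgebra (k : fieldType) := FdAlgebra {
  fda_space :> vectType k;
  fda_mul : {bilinear fda_space -> fda_space -> fda_space}
}.

(* R (x)_k A, in the coordinates given by the library's basis of A; bc_in v is *)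
(* 1 (x) v, and bc_univ below is the universal property.                       *)
Notation bc A R := 'rV[ca_ring R]_(\dim {:fda_space A}).

Section BaseChange.
Variables (k : fieldType) (A : fdAlgebra k) (R : comAlg k).

Definition bc_basis (i : 'I_(\dim {:A})) : A := (vbasis {:A})`_i.

Definition bc_in (v : A) : bc A R := \row_i ca_in R (coord (vbasis {:A}) i v).

Definition bc_mul (x y : bc A R) : bc A R :=
  \sum_i \sum_j
     (x 0 i * y 0 j) *: bc_in (fda_mul A (bc_basis i) (bc_basis j)).

Lemma bc_inD : {morph bc_in : u v / u + v}.
Proof. by move=> u v; apply/rowP => i; rewrite !mxE linearD rmorphD. Qed.

Lemma bc_inZ c v : bc_in (c *: v) = ca_in R c *: bc_in v.
Proof. by apply/rowP => i; rewrite !mxE linearZ rmorphM. Qed.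

Lemma bc_in_sum I (r : seq I) (F : I -> A) :
  bc_in (\sum_(i <- r) F i) = \sum_(i <- r) bc_in (F i).
Proof.
apply: (big_morph _ bc_inD).
by apply/rowP => i; rewrite !mxE linear0 rmorph0.
Qed.

Lemma bc_in_basis i : bc_in (bc_basis i) = delta_mx 0 i.
Proof.
apply/rowP => j; rewrite !mxE coord_free ?rmorph_nat 1?eq_sym //.
exact: basis_free (vbasisP _).
Qed.

Lemma bc_expand (x : bc A R) : x = \sum_i x 0 i *: bc_in (bc_basis i).
Proof.
rewrite {1}[x]row_sum_delta; apply: eq_bigr => i _.
by rewrite bc_in_basis.
Qed.

Lemma fda_expand (v : A) :
  v = \sum_i coord (vbasis {:A}) i v *: bc_basis i.
Proof. exact/coord_vbasis/memvf. Qed.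

Lemma bc_in_mul u v : bc_mul (bc_in u) (bc_in v) = bc_in (fda_mul A u v).
Proof.
rewrite [in RHS](fda_expand u) linear_sumlz bc_in_sum.
apply: eq_bigr => i _.
rewrite [in RHS](fda_expand v) linear_sumr bc_in_sum.
apply: eq_bigr => j _.
by rewrite linearZr_LR linearZl_LR !bc_inZ scalerA !mxE mulrC.
Qed.

Lemma bc_mulDl : left_distributive bc_mul +%R.
Proof.
move=> x y z; rewrite /bc_mul -big_split; apply: eq_bigr => i _ /=.
rewrite -big_split; apply: eq_bigr => j _ /=.
by rewrite mxE mulrDl scalerDl.
Qed.

Lemma bc_mulDr : right_distributive bc_mul +%R.
Proof.
move=> x y z; rewrite /bc_mul -big_split; apply: eq_bigr => i _ /=.
rewrite -big_split; apply: eq_bigr => j _ /=.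
by rewrite mxE mulrDr scalerDl.
Qed.

Lemma bc_mulZl a x y : bc_mul (a *: x) y = a *: bc_mul x y.
Proof.
rewrite /bc_mul scaler_sumr; apply: eq_bigr => i _ /=.
rewrite scaler_sumr; apply: eq_bigr => j _ /=.
by rewrite mxE scalerA mulrA.
Qed.

Lemma bc_mulZr a x y : bc_mul x (a *: y) = a *: bc_mul x y.
Proof.
rewrite /bc_mul scaler_sumr; apply: eq_bigr => i _ /=.
rewrite scaler_sumr; apply: eq_bigr => j _ /=.
by rewrite mxE scalerA mulrCA.
Qed.

Lemma bc_ext (M : lmodType R) (g h : {linear bc A R -> M}) :
  (forall v, g (bc_in v) = h (bc_in v)) -> g =1 h.
Proof.
move=> gh x; rewrite (bc_expand x) !linear_sum.
by apply: eq_bigr => i _; rewrite !linearZ gh.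
Qed.

Lemma bc_univ (M : lmodType R) (f : A -> M)
    (fD : {morph f : u v / u + v})
    (fZ : forall c v, f (c *: v) = ca_in R c *: f v) :
  exists g : {linear bc A R -> M},
    (forall v, g (bc_in v) = f v) /\
    forall h : {linear bc A R -> M}, (forall v, h (bc_in v) = f v) -> h =1 g.
Proof.
pose g (x : bc A R) : M := \sum_i x 0 i *: f (bc_basis i).
have gL : linear g.
  move=> a x y; rewrite /g scaler_sumr -big_split; apply: eq_bigr => i _ /=.
  by rewrite !mxE scalerDl scalerA.
pose gH := GRing.isLinear.Build R (bc A R) M *:%R g gL.
pose G : {linear bc A R -> M} := HB.pack g gH.
have Gin v : G (bc_in v) = f v.
  have f0 : f 0 = 0 by apply: (addrI (f 0)); rewrite -fD !addr0.
  rewrite [in RHS](fda_expand v) (big_morph f fD f0).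
  by apply: eq_bigr => i _; rewrite fZ mxE.
exists G; split => // h hin; apply: bc_ext => v.
by rewrite hin Gin.
Qed.

End BaseChange.

Lemma linear_funP (R : pzRingType) (U V : lmodType R) (f g : {linear U -> V}) :
  f =1 g -> f = g.
Proof.
case: f g => [f [[a] [b]]] [g [[a'] [b']]] /= fg.
have e : f = g by apply: funext.
by subst g; rewrite (Prop_irrelevance a a') (Prop_irrelevance b b').
Qed.

Record algAut (k : fieldType) (A : fdAlgebra k) (R : comAlg k) := AlgAut {
  aut_fun :> {linear bc A R -> bc A R};
  aut_bij : bijective aut_fun;
  autM : {morph aut_fun : x y / bc_mul x y}
}.

Section AutGroup.
Variables (k : fieldType) (A : fdAlgebra k) (R : comAlg k).
Local Notation T := (algAut A R).

Lemma algAutP (g h : T) : g =1 h -> g = h.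
Proof.
case: g h => [g bg mg] [h bh mh] /= /linear_funP e; subst h.
by rewrite (Prop_irrelevance bg bh) (Prop_irrelevance mg mh).
Qed.

Definition aut_one : T :=
  @AlgAut k A R (idfun : {linear bc A R -> bc A R})
    (Bijective (frefl _) (frefl _)) (fun _ _ => erefl).

Lemma aut_mul_morph (g h : T) : {morph g \o h : x y / bc_mul x y}.
Proof. by move=> x y /=; rewrite !autM. Qed.

Definition aut_mul (g h : T) : T :=
  @AlgAut k A R (g \o h : {linear bc A R -> bc A R})
    (bij_comp (aut_bij g) (aut_bij h)) (aut_mul_morph g h).

Lemma aut_inv_subproof (g : T) : exists h : T, cancel g h /\ cancel h g.
Proof.
have [h gK hK] := aut_bij g.
pose hH := GRing.isLinear.Build R (bc A R) (bc A R) *:%R h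
  (can2_linear gK hK).
pose H : {linear bc A R -> bc A R} := HB.pack h hH.
have HM : {morph H : x y / bc_mul x y}.
  by move=> x y /=; rewrite -{1}(hK x) -{1}(hK y) -autM gK.
by exists (@AlgAut k A R H (Bijective hK gK) HM).
Qed.

Definition aut_inv (g : T) : T := sval (cid (aut_inv_subproof g)).

Lemma aut_mulA : associative aut_mul.
Proof. by move=> f g h; apply: algAutP. Qed.
Lemma aut_mul1 : left_id aut_one aut_mul.
Proof. by move=> g; apply: algAutP. Qed.
Lemma aut_mulr1 : right_id aut_one aut_mul.
Proof. by move=> g; apply: algAutP. Qed.
Lemma aut_mulV : left_inverse aut_one aut_inv aut_mul.
Proof.
move=> g; apply: algAutP => x /=; rewrite /aut_inv.
by case: cid => h [/= gK _].
Qed.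
Lemma aut_mulrV : right_inverse aut_one aut_inv aut_mul.
Proof.
move=> g; apply: algAutP => x /=; rewrite /aut_inv.
by case: cid => h [/= _ hK].
Qed.

HB.instance Definition _ := gen_eqMixin T.
HB.instance Definition _ := gen_choiceMixin T.
HB.instance Definition _ :=
  isGroup.Build T aut_mulA aut_mul1 aut_mulr1 aut_mulV aut_mulrV.

End AutGroup.

Section AutMap.
Variables (k : fieldType) (A : fdAlgebra k) (R S : comAlg k) (f : algHom R S).

Definition aut_map_fun (g : {linear bc A R -> bc A R}) :
    {linear bc A S -> bc A S} :=
  mulmxr (map_mx f (lin1_mx g)).

Lemma map_bc_in v : map_mx f (bc_in R v) = bc_in S v :> bc A S.
Proof. by apply/rowP => i; rewrite !mxE ah_in. Qed.

Lemma map_bc_mul (x y : bc A R) :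
  map_mx f (bc_mul x y) = bc_mul (map_mx f x) (map_mx f y).
Proof.
rewrite /bc_mul raddf_sum; apply: eq_bigr => i _.
rewrite raddf_sum; apply: eq_bigr => j _.
by rewrite /= map_mxZ rmorphM map_bc_in !mxE.
Qed.

(* This determines aut_map_fun g, which is therefore S (x)_R g.                *)
Lemma aut_map_funE g (x : bc A R) :
  aut_map_fun g (map_mx f x) = map_mx f (g x).
Proof. by rewrite /= -map_mxM mul_rV_lin1. Qed.

Lemma aut_map_fun_in g v :
  aut_map_fun g (bc_in S v) = map_mx f (g (bc_in R v)).
Proof. by rewrite -map_bc_in aut_map_funE. Qed.

Lemma aut_map_fun_can (g h : {linear bc A R -> bc A R}) :
  cancel g h -> cancel (aut_map_fun g) (aut_map_fun h).
Proof.
move=> gK.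
have hg v : aut_map_fun h (aut_map_fun g (bc_in S v)) = bc_in S v.
  by rewrite aut_map_fun_in aut_map_funE gK map_bc_in.
exact: (bc_ext (g := aut_map_fun h \o aut_map_fun g) (h := idfun) hg).
Qed.

Lemma aut_map_fun_bij (g : algAut A R) : bijective (aut_map_fun g).
Proof.
have [h [gK hK]] := aut_inv_subproof g.
by exists (aut_map_fun h); exact: aut_map_fun_can.
Qed.

Lemma aut_map_fun_mul (g : algAut A R) :
  {morph aut_map_fun g : x y / bc_mul x y}.
Proof.
have gin u v : aut_map_fun g (bc_mul (bc_in S u) (bc_in S v)) =
    bc_mul (aut_map_fun g (bc_in S u)) (aut_map_fun g (bc_in S v)).
  by rewrite -!map_bc_in -map_bc_mul !aut_map_funE -map_bc_mul autM.
have bL (x : bc A S) : linear (bc_mul x).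
  by move=> a y z; rewrite bc_mulDr bc_mulZr.
have bR (x : bc A S) : linear (fun y : bc A S => bc_mul y x).
  by move=> a y z; rewrite bc_mulDl bc_mulZl.
pose L x : {linear bc A S -> bc A S} :=
  HB.pack (bc_mul x) (GRing.isLinear.Build _ _ _ *:%R _ (bL x)).
pose Rr x : {linear bc A S -> bc A S} :=
  HB.pack (fun y : bc A S => bc_mul y x) (GRing.isLinear.Build _ _ _ *:%R _ (bR x)).
pose G := aut_map_fun g.
move=> x y.
apply: (bc_ext (g := G \o L x) (h := L (G x) \o G)) => v.
apply: (bc_ext (g := G \o Rr (bc_in S v)) (h := Rr (G (bc_in S v)) \o G)) => u.
exact: gin.
Qed.

Definition aut_map (g : algAut A R) : algAut A S :=
  AlgAut (aut_map_fun_bij g) (aut_map_fun_mul g).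

Lemma aut_mapM : {morph aut_map : g h / (g * h)%g}.
Proof.
move=> g h; apply: algAutP; apply: bc_ext => v.
rewrite [LHS]aut_map_fun_in.
transitivity (aut_map_fun g (aut_map_fun h (bc_in S v))); last by [].
by rewrite aut_map_fun_in aut_map_funE.
Qed.

End AutMap.

Section AutFunctor.
Variables (k : fieldType) (A : fdAlgebra k).

Lemma aut_map_id (R : comAlg k) (g : algAut A R) : aut_map (algHom_id R) g = g.
Proof.
apply: algAutP; apply: bc_ext => v.
by rewrite [LHS]aut_map_fun_in map_mx_id.
Qed.

Lemma aut_map_comp (R S T : comAlg k) (f2 : algHom S T) (f1 : algHom R S)
    (g : algAut A R) :
  aut_map (algHom_comp f2 f1) g = aut_map f2 (aut_map f1 g).
Proof.
apply: algAutP; apply: bc_ext => v.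
rewrite [LHS]aut_map_fun_in [RHS]aut_map_fun_in.
by rewrite [aut_map f1 g _]aut_map_fun_in -map_mx_comp.
Qed.

Definition Aut_functor : groupFunctor k :=
  @GroupFunctor k (fun R => algAut A R : groupType) (@aut_map k A)
    (@aut_mapM k A) aut_map_id aut_map_comp.

End AutFunctor.

(* Main.v *)
Require Import Defs.
From HB Require Import structures.
From mathcomp Require Import all_boot all_order all_algebra.
From mathcomp Require Import boolp.
From mathcomp Require classical_sets.

(* Let H be the coordinate ring of G.  A large enough finite-dimensional      *)
(* subcoalgebra C of H contains 1, generates H, and, because H is finitely    *)
(* presented (Hilbert basis theorem), has all relations between its elements  *)
(* implied by the multiplication table C x C -> D = C C.  Over any R, a       *)
(* linear automorphism of C which fixes 1, commutes with the left coaction    *)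
(* operators h |-> (l (x) id)(Delta h), and extends to D compatibly with      *)
(* C x C -> D, is right translation by the point of G(R) obtained by          *)
(* composing it with the counit.  So G is the automorphism group of the       *)
(* spaces C and D with one fixed vector, finitely many operators and one      *)
(* bilinear map, and this structure is encoded in a single algebra with the   *)
(* help of a right identity e (which is unique, hence fixed): left            *)
(* multiplication by e has distinct nonzero eigenvalues in k on the pieces,   *)
(* hence any automorphism respects the pieces.                                *)

Set Implicit Arguments.
Unset Strict Implicit.
Unset Printing Implicit Defensive.
Import GRing.Theory.
Local Open Scope ring_scope.

(** * Linear forms and dual bases *)

(** A point x of G(R) acts on functions by right translation, sending h to the function z |-> h(z
    x). On a finite-dimensional subcoalgebra C this action commutes with the operators (l (x) id)
    Delta, fixes 1 and respects products ([point_compatible]). Conversely, let P be an R-linear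
    endomorphism of R (x) C with these properties, and let g be P followed by the counit.
    Commutation forces the matrix entries of P to be the values of g on the matrix coefficients of
    C, so P is translation by g as soon as g comes from a point. The other properties give g(1) = 1
    and g(a) g(b) = g'(a b) for a linear g'. For C large enough this makes g extend to an algebra
    homomorphism H -> R, that is, to a point ([quadratic_subcoalgebra], [compatible_point]): H is a
    quotient of a noetherian polynomial ring ([free_algebra]), so its relations are generated in
    bounded degree ([bounded_extension]).

    Uniqueness of coordinates over an arbitrary R, on which all matrix identities rest, comes from
    contracting an identity at the generic point ([contract_generic]).

    In the encoding algebra the summands are eigenspaces of left multiplication by e. Differences of
    distinct eigenvalues are nonzero in k, hence units in every R, so the summands are recognised
    over every R ([smod_automorphism]). [recognition] carries this to the base change of the algebra
    and checks naturality. *)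

Definition base_alg (k : fieldType) : comAlg k :=
  @ComAlg k k (idfun : {rmorphism k -> k}).

Section Spans.
Variable k : fieldType.
Implicit Types A B R : comAlg k.

Definition klin A R (g : A -> R) : Prop :=
  {morph g : x y / x + y} /\ forall c x, g (ca_in A c * x) = ca_in R c * g x.

Lemma klin0 A R (g : A -> R) : klin g -> g 0 = 0.
Proof. by case=> gD _; apply: (addrI (g 0)); rewrite -gD !addr0. Qed.

Lemma klin_sum A R (g : A -> R) (gL : klin g) I (r : seq I) (c : I -> k)
    (F : I -> A) :
  g (\sum_(i <- r) ca_in A (c i) * F i) = \sum_(i <- r) ca_in R (c i) * g (F i).
Proof.
rewrite (big_morph g gL.1 (klin0 gL)); apply: eq_bigr => i _.
exact: gL.2.
Qed.

Lemma klin_alg A R (f : algHom A R) : klin f.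
Proof. by split=> [x y|c x]; rewrite ?rmorphD ?rmorphM ?ah_in. Qed.

Definition subspace A (P : A -> Prop) : Prop :=
  [/\ P 0, forall x y, P x -> P y -> P (x + y) &
      forall c x, P x -> P (ca_in A c * x)].

Definition lspan A (s : seq A) (x : A) : Prop :=
  forall P : A -> Prop, subspace P -> {in s, forall y, P y} -> P x.

Lemma lspan_subspace A (s : seq A) : subspace (lspan s).
Proof.
split=> [P [] //|x y hx hy P PS hs|c x hx P PS hs]; have [_ PD PZ] := PS.
  exact: PD (hx P PS hs) (hy P PS hs).
exact: PZ (hx P PS hs).
Qed.

Lemma lspan_mem A (s : seq A) x : x \in s -> lspan s x.
Proof. by move=> xs P _ h; exact: h. Qed.

Lemma lspan_trans A (s t : seq A) x :
  {in s, forall y, lspan t y} -> lspan s x -> lspan t x.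
Proof. by move=> st h; exact: h (lspan_subspace t) st. Qed.

Lemma lspan_sub A (s t : seq A) x : {subset s <= t} -> lspan s x -> lspan t x.
Proof. by move=> st; apply: lspan_trans => y /st; apply: lspan_mem. Qed.

Lemma subspace_eq A R (g h : A -> R) :
  klin g -> klin h -> subspace (fun x => g x = h x).
Proof.
move=> gL hL; split=> [|x y|c x]; first by rewrite !klin0.
  by rewrite gL.1 hL.1 => -> ->.
by rewrite gL.2 hL.2 => ->.
Qed.

Lemma subspace_sum A (P : A -> Prop) (PS : subspace P) n (c : 'I_n -> k)
    (F : 'I_n -> A) : (forall i, P (F i)) -> P (\sum_i ca_in A (c i) * F i).
Proof.
move=> PF; have [P0 PD PZ] := PS.
by apply: (big_ind P) => // i _; apply: PZ.
Qed.

(* A linear form is read off a maximal subspace avoiding x, which is a        *)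
(* hyperplane complementary to k x.                                           *)
Lemma klin_separate A (x : A) :
  x != 0 -> exists2 f : A -> base_alg k, klin f & f x = 1.
Proof.
move=> x0.
pose P (U : classical_sets.set A) := (forall y z c, U y -> U z ->
  U (y + ca_in A c * z)) /\ ~ U x.
have [F FP Ftot|U [[UL Ux] Umax]] := @classical_sets.Zorn_bigcup A P.
  split=> [y z c [X FX Xy] [Y FY Yz]|[X FX Xx]]; last by case: (FP X FX).
  have [XY|YX] := Ftot X Y FX FY.
    by exists Y => //; apply: (FP Y FY).1 => //; apply: XY.
  by exists X => //; apply: (FP X FX).1 => //; apply: YX.
have U0 : U 0.
  apply: contrapT => nU0; apply: (Umax (fun y => y = 0)).
    split; first by move=> y Uy; case: nU0;
      rewrite -(addNr y) -[- y]mulN1r -[-1](rmorphN1 (ca_in A)) addrC;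
      apply: UL.
    by move=> /(_ 0 erefl).
  split=> [y z c -> ->|/= xe]; first by rewrite mulr0 addr0.
  by rewrite xe eqxx in x0.
have UZ c y : U y -> U (ca_in A c * y) by move=> /(UL 0 y c U0); rewrite add0r.
have UD y z : U y -> U z -> U (y + z).
  by move=> Uy /(UL y z 1 Uy); rewrite rmorph1 mul1r.
have UN y : U y -> U (- y) by move=> /(UZ (-1)); rewrite rmorphN1 mulN1r.
have ex y : exists c : k, U (y - ca_in A c * x).
  apply: contrapT => nex.
  have nUy : ~ U y by move=> Uy; apply: nex; exists 0;
    rewrite rmorph0 mul0r subr0.
  apply: (Umax (fun z => exists2 w, U w & exists c, z = w + ca_in A c * y)).
    split; first by move=> z Uz; exists z => //; exists 0;
      rewrite rmorph0 mul0r addr0.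
    by move=> /(_ y)h; apply/nUy/h; exists 0 => //; exists 1;
      rewrite rmorph1 mul1r add0r.
  split=> [z z' c [w Uw [d ->]] [w' Uw' [d' ->]]|[w Uw [c xe]]].
    exists (w + ca_in A c * w'); first exact: UL.
    exists (d + c * d').
    by rewrite rmorphD rmorphM mulrDr mulrDl !addrA -(addrA w) (addrC (_ * y))
      addrA mulrA.
  have [c0|c0] := eqVneq c 0.
    by apply: Ux; rewrite xe c0 rmorph0 mul0r addr0.
  apply: nex; exists c^-1.
  have -> : y - ca_in A c^-1 * x = ca_in A (- c^-1) * w.
    rewrite xe mulrDr mulrA -rmorphM mulVf // rmorph1 mul1r rmorphN mulNr.
    by rewrite opprD addrCA subrr addr0.
  exact: UZ.
have uniq_c y c d : U (y - ca_in A c * x) -> U (y - ca_in A d * x) -> c = d.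
  move=> hc hd; apply/eqP; apply: contrapT => /negP cd; apply: Ux.
  rewrite -[x]mul1r -(rmorph1 (ca_in A)).
  have dc : d - c != 0 by rewrite subr_eq0 eq_sym.
  rewrite -(mulVf dc) rmorphM -mulrA; apply: UZ.
  have -> : ca_in A (d - c) * x = (y - ca_in A c * x) - (y - ca_in A d * x).
    by rewrite rmorphB mulrBl opprB [RHS]addrC addrA subrK.
  by apply: UD => //; apply: UN.
pose f y := sval (cid (ex y)); have fP y : U (y - ca_in A (f y) * x) :=
  svalP (cid (ex y)).
exists f.
  split=> [y z|c y]; apply: (uniq_c) (fP _) _.
    by rewrite rmorphD mulrDl opprD addrACA; apply: UD.
  by rewrite rmorphM -mulrA -mulrBr; apply: UZ.
by apply: (uniq_c _ _ _ (fP x)); rewrite rmorph1 mul1r subrr.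
Qed.

End Spans.

(** The coordinate forms live on all of [A], not only on [lspan s], so that they can be contracted
    with one factor of a tensor product. [A] itself may be infinite-dimensional. *)
Record dual_basis (k : fieldType) (A : comAlg k) (s : seq A) := DualBasis {
  db_dim : nat;
  db_vec : 'I_db_dim -> A;
  db_coord : 'I_db_dim -> A -> base_alg k;
  db_lin : forall i, klin (db_coord i);
  db_dual : forall i j, db_coord i (db_vec j) = (i == j)%:R;
  db_span : forall i, lspan s (db_vec i);
  db_expand : forall x, lspan s x ->
    x = \sum_i ca_in A (db_coord i x) * db_vec i
}.
Arguments db_vec {k A s} d.
Arguments db_coord {k A s} d.
Arguments db_span {k A s} d.
Arguments db_lin {k A s} d.
Arguments db_dual {k A s} d.

Section DualBasis.
Variable k : fieldType.
Implicit Types A B R : comAlg k.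

Lemma db_pick A R (s : seq A) (b : dual_basis s) j (c : 'I_(db_dim b) -> R) :
  \sum_i ca_in R (db_coord b j (db_vec b i)) * c i = c j.
Proof.
rewrite (bigD1 j) //= db_dual eqxx rmorph1 mul1r big1 ?addr0 // => i ij.
by rewrite db_dual eq_sym (negPf ij) rmorph0 mul0r.
Qed.

Lemma db_ind A (s : seq A) (b : dual_basis s) (P : A -> Prop) :
  subspace P -> (forall i, P (db_vec b i)) -> forall x, lspan s x -> P x.
Proof. by move=> PS Pv x /(db_expand b) ->; apply: subspace_sum. Qed.

Lemma klin_comb A R n (c : 'I_n -> A -> base_alg k) (e : 'I_n -> R) :
  (forall i, klin (c i)) -> klin (fun x => \sum_i ca_in R (c i x) * e i).
Proof.
move=> cL; split=> [x y|a x].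
  by rewrite -big_split; apply: eq_bigr => i _; rewrite (cL i).1 rmorphD mulrDl.
by rewrite mulr_sumr; apply: eq_bigr => i _; rewrite (cL i).2 rmorphM mulrA.
Qed.

Lemma klin_id A : klin (@id A). Proof. by []. Qed.

Lemma klin_comp A B R (g : B -> R) (f : A -> B) :
  klin g -> klin f -> klin (g \o f).
Proof.
move=> gL fL; split=> [x y|c x] /=; first by rewrite fL.1 gL.1.
by rewrite fL.2 gL.2.
Qed.

Lemma klin_mulr A (a : A) : klin (fun x => x * a).
Proof. by split=> [x y|c x]; rewrite ?mulrDl ?mulrA. Qed.

Lemma klinB A R (g h : A -> R) : klin g -> klin h -> klin (fun x => g x - h x).
Proof.
move=> gL hL; split=> [x y|c x]; first by rewrite gL.1 hL.1 opprD addrACA.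
by rewrite gL.2 hL.2 mulrBr.
Qed.

(** Gram-Schmidt with linear forms: each new vector is reduced by the coordinates found so far, and
    a nonzero residue joins the basis with a form taking the value 1 on it. *)
Lemma dual_basis_exists A (s : seq A) : inhabited (dual_basis s).
Proof.
elim: s => [|h s [[n e c cL ce es ex]]].
  have x0 x : lspan [::] x -> x = 0.
    move=> h; apply: (h (fun y => y = 0)) => //.
    by split=> // [y z -> ->|a y ->]; rewrite ?addr0 ?mulr0.
  constructor.
  exists 0 (fun=> 0) (fun _ _ => 0) => //; [by case|by case|by case|].
  by move=> x /x0 ->; rewrite big_ord0.
have sub x : lspan s x -> lspan (h :: s) x.
  by apply: lspan_sub => y ys; rewrite inE ys orbT.
pose h' := h - \sum_i ca_in A (c i h) * e i.
have ch' i : c i h' = 0.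
  have := klin_sum (cL i) (index_enum 'I_n) (fun j => c j h) e.
  rewrite /h' -mulN1r -(rmorphN1 (ca_in A)) (cL i).1 (cL i).2 => ->.
  under eq_bigr => j _ do rewrite ce /=.
  rewrite (bigD1 i) //= eqxx mulr1 big1 ?addr0 ?mulN1r ?subrr // => j ji.
  by rewrite eq_sym (negPf ji) mulr0.
have [h0|/klin_separate [f fL fh]] := eqVneq h' 0.
  constructor.
  exists n e c => //; first by move=> i; apply: sub.
  move=> x xs; apply: (xs _ (subspace_eq (@klin_id A) (klin_comb e cL))) => y.
  rewrite inE => /orP[/eqP -> |ys]; first by apply/eqP; rewrite -subr_eq0;
    apply/eqP.
  exact: (ex y (lspan_mem ys)).
(* The correction makes the new form vanish on the old basis; the value at [h'] stays 1 because all
   old coordinates of [h'] are 0. *)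
pose f' x : base_alg k := f x - \sum_i ca_in (base_alg k) (c i x) * f (e i).
have f'L : klin f' by apply: klinB => //; apply: klin_comb.
have f'h : f' h' = 1.
  by rewrite /f' fh big1 ?subr0 // => i _; rewrite ch' rmorph0 mul0r.
have f'e i : f' (e i) = 0.
  rewrite /f' (bigD1 i) //= ce eqxx mul1r big1 ?addr0 ?subrr // => j ji.
  by rewrite ce (negPf ji) /= mul0r.
pose E (i : 'I_n.+1) := if unlift ord0 i is Some j then e j else h'.
pose D (i : 'I_n.+1) := if unlift ord0 i is Some j then c j else f'.
have DL i : klin (D i) by rewrite /D; case: unliftP.
have S x : \sum_i ca_in A (D i x) * E i =
    ca_in A (f' x) * h' + \sum_i ca_in A (c i x) * e i.
  rewrite big_ord_recl /D /E unlift_none; congr (_ + _).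
  by apply: eq_bigr => i _; rewrite liftK.
constructor.
exists n.+1 E D => //.
- move=> i j; rewrite /D /E; case: (unliftP ord0 i) => [i' ->|->];
    case: (unliftP ord0 j) => [j' ->|->].
  + by rewrite ce (inj_eq (@lift_inj _ ord0)).
  + by rewrite ch' eq_sym (negPf (neq_lift _ _)).
  + by rewrite f'e (negPf (neq_lift _ _)).
  + by rewrite f'h eqxx.
- have [_ lD lZ] := lspan_subspace (h :: s).
  move=> i; rewrite /E; case: unliftP => [j _|_]; first exact: sub.
  rewrite /h'; apply: lD; first by apply: lspan_mem; rewrite inE eqxx.
  rewrite -mulN1r -(rmorphN1 (ca_in A)); apply: lZ.
  by apply: subspace_sum => [|j]; [exact: lspan_subspace|apply: sub].
- move=> x xs; apply: (xs _ (subspace_eq (@klin_id A) (klin_comb E DL))) => y.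
  rewrite S inE => /orP[/eqP ->|/lspan_mem ys].
    have -> : f' h = 1.
      have -> : h = h' + \sum_i ca_in A (c i h) * e i by rewrite /h' subrK.
      rewrite f'L.1 (klin_sum f'L) f'h big1 ?addr0 // => i _.
      by rewrite f'e mulr0.
    by rewrite rmorph1 mul1r /h' subrK.
  rewrite -(ex _ ys).
  have -> : f' y = 0.
    rewrite (ex _ ys) (klin_sum f'L) big1 // => i _.
    by rewrite f'e mulr0.
  by rewrite rmorph0 mul0r add0r.
Qed.

End DualBasis.

(** * Tensor product of commutative algebras *)

Section Tensor.
Local Open Scope quotient_scope.
Variables (k : fieldType) (A B : comAlg k).

Definition bilin (R : comAlg k) (f : A -> B -> R) : Prop :=
  (forall b, klin (f^~ b)) /\ (forall a, klin (f a)).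

Definition tsum (R : comAlg k) (f : A -> B -> R) (t : seq (A * B)) : R :=
  \sum_(p <- t) f p.1 p.2.

(* A (x) B is the set of formal sums of pure tensors, two of them being equal *)
(* when no bilinear map to a commutative algebra separates them.              *)
Definition tensor_rel (s t : seq (A * B)) : bool :=
  `[< forall (R : comAlg k) (f : A -> B -> R), bilin f -> tsum f s =
    tsum f t >].

Lemma tensor_rel_equiv : equiv_class_of tensor_rel.
Proof.
split=> [s|s t|t s u]; first by apply/asboolP.
  by apply/asboolP/asboolP => h R f fB; rewrite (h R f fB).
move=> /asboolP st /asboolP tu; apply/asboolP => R f fB.
by rewrite (st R f fB) (tu R f fB).
Qed.

Canonical tensor_equiv := EquivRelPack tensor_rel_equiv.
Canonical tensor_encModRel := defaultEncModRel tensor_rel.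

Definition tensor := {eq_quot tensor_rel}.
HB.instance Definition _ : EqQuotient _ tensor_rel tensor :=
  EqQuotient.on tensor.
HB.instance Definition _ := Choice.on tensor.

Definition tlift (R : comAlg k) (f : A -> B -> R) (x : tensor) : R :=
  tsum f (repr x).

Lemma tlift_pi (R : comAlg k) (f : A -> B -> R) (fB : bilin f) s :
  tlift f (\pi_tensor s) = tsum f s.
Proof.
have : tensor_rel (repr (\pi_tensor s)) s.
  by rewrite -[tensor_rel _ _]/(tensor_equiv _ _) -eqmodE reprK.
by move/asboolP; apply.
Qed.

(** Immediate from the choice of the relation. It reduces every ring law of the tensor product to an
    identity between values of bilinear maps. *)
Lemma tensor_ext (x y : tensor) :
  (forall (R : comAlg k) (f : A -> B -> R), bilin f -> tlift f x = tlift f y) ->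
  x = y.
Proof.
move=> h; rewrite -[x]reprK -[y]reprK; apply/eqP; rewrite eqmodE.
exact/asboolP.
Qed.

Definition tzero : tensor := \pi_tensor [::].
Definition tadd (x y : tensor) : tensor := \pi_tensor (repr x ++ repr y).
Definition topp (x : tensor) : tensor :=
  \pi_tensor [seq (- p.1, p.2) | p <- repr x].
Definition tone : tensor := \pi_tensor [:: (1, 1)].
Definition tmul (x y : tensor) : tensor :=
  \pi_tensor [seq (p.1 * q.1, p.2 * q.2) | p <- repr x, q <- repr y].

Section Lift.
Variables (R : comAlg k) (f : A -> B -> R) (fB : bilin f).

Lemma tlift0 : tlift f tzero = 0.
Proof. by rewrite tlift_pi // /tsum big_nil. Qed.

Lemma tliftD x y : tlift f (tadd x y) = tlift f x + tlift f y.
Proof. by rewrite tlift_pi // /tsum big_cat. Qed.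

Lemma tliftN x : tlift f (topp x) = - tlift f x.
Proof.
rewrite tlift_pi // /tlift /tsum big_map -sumrN /=; apply: eq_bigr => p _.
have /= := (fB.1 p.2).2 (-1) p.1.
by rewrite !rmorphN1 !mulN1r.
Qed.

Lemma tlift1 : tlift f tone = f 1 1.
Proof. by rewrite tlift_pi // /tsum big_seq1. Qed.

Lemma tliftM x y : tlift f (tmul x y) =
  tlift (fun a b => tlift (fun c d => f (a * c) (b * d)) y) x.
Proof. by rewrite tlift_pi // /tsum big_allpairs_dep. Qed.

Lemma bilin_shift a b : bilin (fun c d => f (a * c) (b * d)).
Proof.
split=> [d|c]; split=> [x y|s x] /=.
- by rewrite mulrDr (fB.1 _).1.
- by rewrite mulrCA (fB.1 _).2.
- by rewrite mulrDr (fB.2 _).1.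
- by rewrite mulrCA (fB.2 _).2.
Qed.

Lemma bilin_tlift y : bilin (fun a b => tlift (fun c d => f (a * c) (b * d)) y).
Proof.
rewrite /tlift /tsum.
split=> [b|a]; split=> [a1 a2|s a1] /=.
- by rewrite -big_split; apply: eq_bigr => p _; rewrite mulrDl (fB.1 _).1.
- by rewrite mulr_sumr; apply: eq_bigr => p _; rewrite -mulrA (fB.1 _).2.
- by rewrite -big_split; apply: eq_bigr => p _; rewrite mulrDl (fB.2 _).1.
- by rewrite mulr_sumr; apply: eq_bigr => p _; rewrite -mulrA (fB.2 _).2.
Qed.

End Lift.

Lemma eq_tlift (R : comAlg k) (f g : A -> B -> R) x :
  (forall a b, f a b = g a b) -> tlift f x = tlift g x.
Proof. by move=> fg; apply: eq_bigr => p _; apply: fg. Qed.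

Lemma taddA : associative tadd.
Proof. by move=> x y z; apply: tensor_ext => R f fB;
  rewrite !tliftD // addrA. Qed.

Lemma taddC : commutative tadd.
Proof. by move=> x y; apply: tensor_ext => R f fB;
  rewrite !tliftD // addrC. Qed.

Lemma tadd0 : left_id tzero tadd.
Proof. by move=> x; apply: tensor_ext => R f fB;
  rewrite tliftD // tlift0 // add0r. Qed.

Lemma taddN : left_inverse tzero topp tadd.
Proof.
by move=> x; apply: tensor_ext => R f fB;
  rewrite tliftD // tliftN // tlift0 // addNr.
Qed.

HB.instance Definition _ :=
  GRing.isZmodule.Build tensor taddA taddC tadd0 taddN.

Lemma tmulA : associative tmul.
Proof.
move=> x y z; apply: tensor_ext => R f fB.
rewrite !tliftM //; last exact: bilin_tlift.
apply: eq_tlift => a b; rewrite tliftM; last exact: bilin_shift.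
by apply: eq_tlift => a' b'; apply: eq_tlift => c d; rewrite !mulrA.
Qed.

Lemma tmulC : commutative tmul.
Proof.
move=> x y; apply: tensor_ext => R f fB.
rewrite !tliftM // /tlift /tsum exchange_big; apply: eq_bigr => p _.
by apply: eq_bigr => q _; rewrite mulrC (mulrC q.2).
Qed.

Lemma tmul1 : left_id tone tmul.
Proof.
move=> x; apply: tensor_ext => R f fB.
rewrite tliftM // tlift1; last exact: bilin_tlift.
by apply: eq_tlift => a b; rewrite !mul1r.
Qed.

Lemma tmulD : left_distributive tmul tadd.
Proof.
move=> x y z; apply: tensor_ext => R f fB.
by rewrite tliftD // !tliftM // tliftD //; apply: bilin_tlift.
Qed.

HB.instance Definition _ :=
  GRing.Zmodule_isComPzRing.Build tensor tmulA tmulC tmul1 tmulD.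

Definition pure (a : A) (b : B) : tensor := \pi_tensor [:: (a, b)].

Lemma tlift_pure (R : comAlg k) (f : A -> B -> R) (fB : bilin f) a b :
  tlift f (pure a b) = f a b.
Proof. by rewrite tlift_pi // /tsum big_seq1. Qed.

Lemma tlift_add (R : comAlg k) (f : A -> B -> R) (fB : bilin f) :
  {morph tlift f : x y / x + y}.
Proof. by move=> x y; exact: tliftD. Qed.

Lemma pureDl a a' b : pure (a + a') b = pure a b + pure a' b.
Proof.
by apply: tensor_ext => R f fB; rewrite tliftD // !tlift_pure // (fB.1 b).1.
Qed.

Lemma pureDr a b b' : pure a (b + b') = pure a b + pure a b'.
Proof.
by apply: tensor_ext => R f fB; rewrite tliftD // !tlift_pure // (fB.2 a).1.
Qed.

Lemma pureM a b a' b' : pure (a * a') (b * b') = pure a b * pure a' b'.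
Proof.
apply: tensor_ext => R f fB; rewrite tliftM // !tlift_pure //; last first.
  exact: bilin_tlift.
exact: bilin_shift.
Qed.

Lemma pure_scal c : pure (ca_in A c) 1 = pure 1 (ca_in B c).
Proof.
apply: tensor_ext => R f fB; rewrite !tlift_pure //.
by rewrite -[ca_in A c]mulr1 -[ca_in B c]mulr1 (fB.1 1).2 (fB.2 1).2.
Qed.

Lemma tensor_expand x : x = \sum_(p <- repr x) pure p.1 p.2.
Proof.
apply: tensor_ext => R f fB.
rewrite (big_morph _ (tlift_add fB) (tlift0 fB)).
by apply: eq_bigr => p _; rewrite tlift_pure.
Qed.

Lemma pure_ring_l : zmod_morphism (pure^~ 1) * monoid_morphism (pure^~ 1).
Proof.
split; last by split=> // x y; rewrite -pureM mulr1.
by move=> x y; apply: (addIr (pure y 1)); rewrite -pureDl !subrK.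
Qed.

Lemma pure_ring_r : zmod_morphism (pure 1) * monoid_morphism (pure 1).
Proof.
split; last by split=> // x y; rewrite -pureM mulr1.
by move=> x y; apply: (addIr (pure 1 y)); rewrite -pureDr !subrK.
Qed.

Definition tinl_rm : {rmorphism A -> tensor} :=
  HB.pack (pure^~ 1)
    (GRing.isZmodMorphism.Build _ _ _ pure_ring_l.1)
    (GRing.isMonoidMorphism.Build _ _ _ pure_ring_l.2).

Definition tinr_rm : {rmorphism B -> tensor} :=
  HB.pack (pure 1)
    (GRing.isZmodMorphism.Build _ _ _ pure_ring_r.1)
    (GRing.isMonoidMorphism.Build _ _ _ pure_ring_r.2).

Definition tensor_alg : comAlg k :=
  @ComAlg k tensor (tinl_rm \o ca_in A : {rmorphism k -> tensor}).

Definition tinl : algHom A tensor_alg :=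
  @AlgHom k A tensor_alg tinl_rm (fun _ => erefl).
Definition tinr : algHom B tensor_alg :=
  @AlgHom k B tensor_alg tinr_rm (fun c => esym (pure_scal c)).

Lemma pureE a b : pure a b = tinl a * tinr b.
Proof. by rewrite -[LHS]/(pure a b) /= -pureM mulr1 mul1r. Qed.

Lemma tensor_decomp (x : tensor_alg) :
  exists t : seq (A * B), x = \sum_(p <- t) tinl p.1 * tinr p.2.
Proof.
by exists (repr x); rewrite {1}[x]tensor_expand; apply: eq_bigr => p _;
  rewrite pureE.
Qed.

Lemma tensor_univ (R : comAlg k) (f : algHom A R) (g : algHom B R) :
  exists h : algHom tensor_alg R,
    (forall a, h (tinl a) = f a) /\ (forall b, h (tinr b) = g b).
Proof.
pose F a b := f a * g b.
have FB : bilin F.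
  split=> [b|a]; split=> [x y|c x]; rewrite /F.
  - by rewrite rmorphD mulrDl.
  - by rewrite rmorphM ah_in mulrA.
  - by rewrite rmorphD mulrDr.
  - by rewrite rmorphM ah_in mulrCA.
have hB : zmod_morphism (tlift F).
  move=> x y; apply: (addIr (tlift F y)); rewrite -tlift_add //.
  by rewrite !subrK.
have hM : monoid_morphism (tlift F).
  split; first by rewrite tlift1 // /F !rmorph1 mulr1.
  move=> x y; rewrite [LHS]tliftM // /tlift /tsum mulr_suml.
  apply: eq_bigr => p _; rewrite mulr_sumr; apply: eq_bigr => q _.
  by rewrite /F !rmorphM mulrACA.
pose h : {rmorphism tensor -> R} := HB.pack (tlift F)
  (GRing.isZmodMorphism.Build _ _ _ hB) (GRing.isMonoidMorphism.Build _ _ _ hM).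
have hin c : h (ca_in tensor_alg c) = ca_in R c.
  by rewrite /= tlift_pure // /F rmorph1 mulr1 ah_in.
exists (@AlgHom k tensor_alg R h hin); split=> [a|b] /=.
  by rewrite tlift_pure // /F rmorph1 mulr1.
by rewrite tlift_pure // /F rmorph1 mul1r.
Qed.

(** This is the map l (x) id, which exists because [ca_in B (l a) * b] is bilinear with values in a
    commutative algebra, namely [B]. *)
Lemma tensor_contract (l : A -> base_alg k) : klin l ->
  exists2 h : tensor_alg -> B, {morph h : x y / x + y} &
    forall a b, h (tinl a * tinr b) = ca_in B (l a) * b.
Proof.
move=> lL; pose F a b := ca_in B (l a) * b.
have FB : bilin F.
  split=> [b|a]; split=> [x y|c x]; rewrite /F.
  - by rewrite lL.1 rmorphD mulrDl.
  - by rewrite lL.2 rmorphM mulrA.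
  - by rewrite mulrDr.
  - by rewrite mulrCA.
exists (tlift F); first exact: tlift_add.
by move=> a b; rewrite -pureE tlift_pure.
Qed.

End Tensor.

(** * Hilbert basis theorem and free commutative algebras *)

Section Noetherian.

Definition ideal (A : comPzRingType) (I : A -> Prop) : Prop :=
  [/\ I 0, forall x y, I x -> I y -> I (x + y) & forall a x, I x -> I (a * x)].

Definition ideal_gen (A : comPzRingType) (s : seq A) (x : A) : Prop :=
  forall I : A -> Prop, ideal I -> {in s, forall y, I y} -> I x.

Definition noetherian (A : comPzRingType) : Prop :=
  forall I : A -> Prop, ideal I ->
    exists2 s : seq A, {in s, forall y, I y} & forall x, I x -> ideal_gen s x.

Lemma ideal_gen_ideal (A : comPzRingType) (s : seq A) : ideal (ideal_gen s).
Proof.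
split=> [I [] //|x y hx hy I IS hs|a x hx I IS hs]; have [_ ID IM] := IS.
  exact: ID (hx I IS hs) (hy I IS hs).
exact: IM (hx I IS hs).
Qed.

Lemma ideal_gen_mem (A : comPzRingType) (s : seq A) x : x \in s ->
  ideal_gen s x.
Proof. by move=> xs I _ h; exact: h. Qed.

Lemma ideal_gen_sub (A : comPzRingType) (s t : seq A) x :
  {subset s <= t} -> ideal_gen s x -> ideal_gen t x.
Proof.
move=> st h; apply: h (ideal_gen_ideal t) _ => y /st.
exact: ideal_gen_mem.
Qed.

Lemma field_noetherian (k : fieldType) : noetherian k.
Proof.
move=> I II; have [I0 ID IM] := II.
have [[x Ix x0]|n] := pselect (exists2 x, I x & x != 0).
  exists [:: x] => [y|y _ J [_ _ JM] /(_ x (mem_head _ _)) Jx].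
    by rewrite inE => /eqP ->.
  by rewrite -(divfK x0 y); apply: JM.
exists [::] => // x Ix J [J0 _ _] _.
have [-> //|x0] := eqVneq x 0.
by case: n; exists x.
Qed.

Section HilbertBasis.
Variables (A : comNzRingType) (Anoeth : noetherian A).
Variables (I : {poly A} -> Prop) (Iid : ideal I).

(** For an ideal [J] these are the leading coefficients of its elements of degree [j], together with
    0. *)
Let coef_ideal (J : {poly A} -> Prop) j (a : A) : Prop :=
  exists p, [/\ J p, (size p <= j.+1)%N & p`_j = a].

Let coef_idealP (J : {poly A} -> Prop) j : ideal J -> ideal (coef_ideal J j).
Proof.
move=> [J0 JD JM]; split; first by exists 0; rewrite size_poly0 coef0.
  move=> _ _ [p [Jp sp <-]] [q [Jq sq <-]]; exists (p + q); split=> //.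
  - exact: JD.
  - by rewrite (leq_trans (size_polyD _ _)) // geq_max sp sq.
  - by rewrite coefD.
move=> a _ [p [Jp sp <-]]; exists (a%:P * p); split; first exact: JM.
  by rewrite mul_polyC (leq_trans (size_scale_leq _ _)).
by rewrite coefCM.
Qed.

Let coef_ideal_shift (J : {poly A} -> Prop) i j a :
  ideal J -> (i <= j)%N -> coef_ideal J i a -> coef_ideal J j a.
Proof.
move=> [_ _ JM] ij [p [Jp sp <-]]; exists ('X^(j - i) * p); split.
- exact: JM.
- apply/leq_sizeP => l jl; rewrite coefXnM ltnNge.
  rewrite (leq_trans (leq_subr i j)) ?(ltnW jl) //=.
  move/leq_sizeP: sp; apply.
  by rewrite ltn_subRL; apply: leq_ltn_trans jl; rewrite subnK.
- by rewrite coefXnM ltnNge leq_subr /= subKn.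
Qed.

Let coef_ideal_sub (s t : seq {poly A}) j a :
  {subset s <= t} -> coef_ideal (ideal_gen s) j a ->
    coef_ideal (ideal_gen t) j a.
Proof.
by move=> st [p [ps sp pa]]; exists p; split=> //; apply: ideal_gen_sub ps.
Qed.

Let finite_witness (s : seq A) :
  {in s, forall a, exists j, coef_ideal I j a} ->
  exists m, exists2 t : seq {poly A}, {in t, forall p, I p} &
    {in s, forall a j, (m <= j)%N -> coef_ideal (ideal_gen t) j a}.
Proof.
elim: s => [|a s IH] h; first by exists 0, [::].
have [|m [t tI ts]] := IH; first by move=> b bs; apply: h; rewrite inE bs orbT.
have [i [p [Ip sp pa]]] := h a (mem_head _ _).
exists (maxn i m), (p :: t).
  by move=> q; rewrite inE => /orP[/eqP -> //|/tI].
move=> b; rewrite inE => /orP[/eqP ->|bs] j; rewrite geq_max => /andP[ij mj].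
  apply: (coef_ideal_shift (ideal_gen_ideal _) ij); exists p; split=> //.
  exact: ideal_gen_mem (mem_head _ _).
by apply: coef_ideal_sub (ts b bs j mj) => q qt; rewrite inE qt orbT.
Qed.

Let finite_witness_at (s : seq A) j :
  {in s, forall a, coef_ideal I j a} ->
  exists2 t : seq {poly A}, {in t, forall p, I p} &
    {in s, forall a, coef_ideal (ideal_gen t) j a}.
Proof.
elim: s => [|a s IH] h; first by exists [::].
have [|t tI ts] := IH; first by move=> b bs; apply: h; rewrite inE bs orbT.
have [p [Ip sp pa]] := h a (mem_head _ _).
exists (p :: t).
  by move=> q; rewrite inE => /orP[/eqP -> //|/tI].
move=> b; rewrite inE => /orP[/eqP ->|bs].
  exists p; split=> //; exact: ideal_gen_mem (mem_head _ _).
by apply: coef_ideal_sub (ts b bs) => q qt; rewrite inE qt orbT.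
Qed.

Let leading_ideal (a : A) : Prop := exists j, coef_ideal I j a.

Let leading_idealP : ideal leading_ideal.
Proof.
split; first by exists 0; case: (coef_idealP 0 Iid).
  move=> x y [i xi] [j yj]; exists (maxn i j).
  have [_ D _] := coef_idealP (maxn i j) Iid; apply: D.
    exact: coef_ideal_shift (leq_maxl _ _) xi.
  exact: coef_ideal_shift (leq_maxr _ _) yj.
by move=> a x [i xi]; exists i; have [_ _ M] := coef_idealP i Iid; apply: M.
Qed.

Let small_degrees m : exists2 t : seq {poly A}, {in t, forall p, I p} &
  forall j a, (j < m)%N -> coef_ideal I j a -> coef_ideal (ideal_gen t) j a.
Proof.
elim: m => [|m [t tI th]]; first by exists [::].
have [s sL sgen] := Anoeth (coef_idealP m Iid).
have [u uI uh] := finite_witness_at sL.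
exists (t ++ u) => [p|j a].
  by rewrite mem_cat => /orP[/tI|/uI].
rewrite ltnS leq_eqVlt => /orP[/eqP ->|jm] aj; last first.
  by apply: coef_ideal_sub (th j a jm aj) => q qt; rewrite mem_cat qt.
apply: (sgen a aj _ (coef_idealP m (ideal_gen_ideal _))) => b bs.
by apply: coef_ideal_sub (uh b bs) => q qt; rewrite mem_cat qt orbT.
Qed.

(** Finitely many polynomials account for all leading coefficients from some degree [m] on, and
    finitely many more for the degrees below [m]. Subtracting a suitable element of the ideal they
    generate then lowers the size of any element of [I]. *)
Lemma hilbert_basis_ideal : exists2 t : seq {poly A},
  {in t, forall p, I p} & forall p, I p -> ideal_gen t p.
Proof.
have [s sL sgen] := Anoeth leading_idealP.
have [m [u uI uh]] := finite_witness sL.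
have [t tI th] := small_degrees m.
pose F := t ++ u.
have FI : {in F, forall p, I p} by move=> p; rewrite mem_cat => /orP[/tI|/uI].
have key j a : coef_ideal I j a -> coef_ideal (ideal_gen F) j a.
  have [jm|mj] := ltnP j m => aj.
    by apply: coef_ideal_sub (th j a jm aj) => q qt; rewrite mem_cat qt.
  have al : leading_ideal a by exists j.
  apply: (sgen a al _ (coef_idealP j (ideal_gen_ideal _))) => b bs.
  by apply: coef_ideal_sub (uh b bs j mj) => q qt; rewrite mem_cat qt orbT.
exists F => // p; have [n] := ubnP (size p); elim: n p => // n IH p.
rewrite ltnS; case: n IH => [|n] IH sp Ip.
  move: sp; rewrite leqn0 size_poly_eq0 => /eqP ->.
  by case: (ideal_gen_ideal F).
have [q [qF sq qa]] : coef_ideal (ideal_gen F) n p`_n by apply: key; exists p.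
have [_ FD FM] := ideal_gen_ideal F; have [_ ID IM] := Iid.
rewrite -(subrK q p); apply: FD => //; apply: IH.
  rewrite ltnS; apply/leq_sizeP => l; rewrite leq_eqVlt coefB =>
    /orP[/eqP <-|nl].
    by rewrite qa subrr.
  by rewrite (leq_sizeP _ _ sp) // (leq_sizeP _ _ sq) // subrr.
apply: ID => //; rewrite -mulN1r; apply: IM.
exact: qF.
Qed.

End HilbertBasis.

Lemma hilbert_basis (A : comNzRingType) : noetherian A -> noetherian {poly A}.
Proof. by move=> An I Iid; apply: hilbert_basis_ideal. Qed.

End Noetherian.

(** * Iterated polynomial rings as free commutative algebras *)

Section FreeAlgebra.
Variable k : fieldType.

Definition generates (A : comAlg k) (s : seq A) : Prop :=
  forall P : A -> Prop,
    (forall c : k, P (ca_in A c)) ->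
    (forall x, x \in s -> P x) ->
    (forall x y, P x -> P y -> P (x + y)) ->
    (forall x y, P x -> P y -> P (x * y)) ->
    forall x, P x.

Lemma zero_ring_eq (R : comPzRingType) (x y : R) : 1 = 0 :> R -> x = y.
Proof. by move=> h; rewrite -[x]mul1r -[y]mul1r h !mul0r. Qed.

Lemma poly_univ (A : comNzRingType) (R : comPzRingType) (f : {rmorphism A -> R})
  (v : R) : exists2 h : {rmorphism {poly A} -> R},
    forall a, h a%:P = f a & h 'X = v.
Proof.
(* Into the zero ring every map is a morphism; otherwise [R] is a nonzero ring and evaluation at [v]
   applies. *)
have [R0|R0] := eqVneq (1 : R) 0.
  have zB : zmod_morphism (fun _ : {poly A} => 0 : R) by move=> x y;
    apply: zero_ring_eq.
  have zM : monoid_morphism (fun _ : {poly A} => 0 : R).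
    by split=> [|x y]; apply: zero_ring_eq.
  pose h : {rmorphism {poly A} -> R} := HB.pack (fun _ : {poly A} => 0 : R)
    (GRing.isZmodMorphism.Build _ _ _ zB)
      (GRing.isMonoidMorphism.Build _ _ _ zM).
  by exists h => [a|]; apply: zero_ring_eq.
pose R' : comNzRingType :=
  HB.pack (GRing.ComPzRing.sort R) (GRing.PzSemiRing_isNonZero.Build R R0).
pose f' : {rmorphism A -> R'} := f.
have cfv : commr_rmorph f' (v : R') by move=> a; exact: mulrC.
pose h : {rmorphism {poly A} -> R'} := horner_morph cfv.
exists h => [a|]; first exact: (horner_morphC cfv).
exact: (horner_morphX cfv).
Qed.

Lemma free_algebra n : exists (S : comAlg k) (x : seq S),
  [/\ size x = n, noetherian S, generates x &
    forall (R : comAlg k) (v : seq R), size v = n ->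
      exists f : algHom S R, [seq f y | y <- x] = v].
Proof.
suff [S [g [x [sx Sn Sg Su]]]] : exists (S : comNzRingType)
    (g : {rmorphism k -> S}) (x : seq (ComAlg g)),
  [/\ size x = n, noetherian S, generates x &
    forall (R : comAlg k) (v : seq R), size v = n ->
      exists f : algHom (ComAlg g) R, [seq f y | y <- x] = v].
  by exists (ComAlg g), x.
elim: n => [|n [S [g [x [sx Sn Sg Su]]]]].
  exists k, (idfun : {rmorphism k -> k}), [::]; split=> //.
  - exact: field_noetherian.
  - by move=> P Pk _ _ _ c; apply: Pk.
  - by move=> R [|//] _; exists (@AlgHom k (base_alg k) R (ca_in R) (fun _ =>
      erefl)).
pose pC : {rmorphism S -> {poly S}} := polyC.
exists {poly S}, (pC \o g : {rmorphism k -> {poly S}}).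
exists ('X :: [seq polyC y | y <- x]); split.
- by rewrite /= size_map sx.
- exact: hilbert_basis.
- move=> P Pk Px PD PM; have PC (a : S) : P a%:P.
    apply: (Sg (fun a : S => P a%:P)) => [c|y yx|y z|y z].
    + exact: Pk.
    + by apply: Px; rewrite inE map_f ?orbT.
    + by rewrite polyCD; apply: PD.
    + by rewrite polyCM; apply: PM.
  by apply: poly_ind => [|p c Pp]; [exact: PC|apply: PD => //; apply: PM => //;
    apply: Px; exact: mem_head].
move=> R [//|v0 v] /= [sv].
have [f fv] := Su R v sv.
have [h hC hX] := poly_univ (f : {rmorphism S -> R}) v0.
have hin c : h (pC (g c)) = ca_in R c by rewrite hC (ah_in f).
exists (@AlgHom k (ComAlg (pC \o g : {rmorphism k -> {poly S}})) R h hin).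
by rewrite /= hX -map_comp -fv; congr (_ :: _); apply: eq_map => y /=;
  rewrite hC.
Qed.

End FreeAlgebra.

(** * Extending truncated homomorphisms *)

Section Powers.
Variable k : fieldType.
Implicit Types A H R : comAlg k.

Definition prods A (s t : seq A) : seq A := [seq x * y | x <- s, y <- t].

Fixpoint pow A (s : seq A) (d : nat) : seq A :=
  if d is d'.+1 then prods s (pow s d') else [:: 1].

Lemma mem_prods A (s t : seq A) x y : x \in s -> y \in t -> x * y \in prods s t.
Proof. by move=> xs yt; apply/allpairsP; exists (x, y). Qed.

Lemma pow_mono A (s : seq A) i j :
  1 \in s -> (i <= j)%N -> {subset pow s i <= pow s j}.
Proof.
move=> s1 /subnKC <-; elim: (j - i)%N => [|m IH]; first by rewrite addn0.
move=> x /IH xs; rewrite addnS -[x]mul1r.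
exact: mem_prods.
Qed.

Lemma pow_map A R (f : algHom A R) (s : seq A) d :
  [seq f x | x <- pow s d] = pow [seq f x | x <- s] d.
Proof.
elim: d => [|d IH] /=; first by rewrite rmorph1.
rewrite -IH /prods map_allpairs allpairs_mapl allpairs_mapr.
by apply: eq_allpairs => x y; rewrite rmorphM.
Qed.

Lemma pow_mul A (s : seq A) i j x y :
  x \in pow s i -> y \in pow s j -> x * y \in pow s (i + j).
Proof.
elim: i x => [|i IH] x /=; first by rewrite inE => /eqP ->; rewrite mul1r.
move=> /allpairsP[[a b] /= [xa xb ->]] yj; rewrite -mulrA.
by apply: mem_prods => //; apply: IH.
Qed.

Lemma lspan_mul A (s t u : seq A) x y :
  {in s & t, forall a b, lspan u (a * b)} ->
  lspan s x -> lspan t y -> lspan u (x * y).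
Proof.
move=> stu xs yt; have [u0 uD uZ] := lspan_subspace u.
apply: (xs (fun x => lspan u (x * y))) => [|a as_].
  split=> [|z z'|c z]; first by rewrite mul0r.
    by rewrite mulrDl; apply: uD.
  by rewrite -mulrA; apply: uZ.
apply: (yt (fun y => lspan u (a * y))) => [|b bt]; last exact: stu.
split=> [|z z'|c z]; first by rewrite mulr0.
  by rewrite mulrDr; apply: uD.
by rewrite mulrCA; apply: uZ.
Qed.

Lemma lspan_pow_mono A (s : seq A) i j x :
  (i <= j)%N -> lspan (pow (1 :: s) i) x -> lspan (pow (1 :: s) j) x.
Proof. by move=> ij; apply: lspan_sub; apply: pow_mono (mem_head _ _) ij. Qed.

Lemma generates_pow A (s : seq A) : generates s ->
  forall x, exists d, lspan (pow (1 :: s) d) x.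
Proof.
apply=> [c|x xs|x y [i xi] [j yj]|x y [i xi] [j yj]].
- exists 0; have [_ _ Z] := lspan_subspace (pow (1 :: s) 0).
  by rewrite -[ca_in A c]mulr1; apply: Z; apply: lspan_mem; rewrite inE.
- exists 1; apply: lspan_mem; rewrite -[x]mulr1.
  by apply: mem_prods; rewrite ?inE ?xs ?orbT.
- exists (maxn i j); have [_ D _] := lspan_subspace (pow (1 :: s) (maxn i j)).
  apply: D; first exact: lspan_pow_mono (leq_maxl _ _) xi.
  exact: lspan_pow_mono (leq_maxr _ _) yj.
- exists (i + j)%N; apply: lspan_mul xi yj => a b ai bj.
  exact: lspan_mem (pow_mul ai bj).
Qed.

Lemma generates_surj A H (f : algHom A H) (s : seq A) :
  generates [seq f x | x <- s] -> forall y, exists x, f x = y.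
Proof.
apply=> [c|_ /mapP[x _ ->]|_ _ [x <-] [y <-]|_ _ [x <-] [y <-]].
- by exists (ca_in A c); rewrite ah_in.
- by exists x.
- by exists (x + y); rewrite rmorphD.
- by exists (x * y); rewrite rmorphM.
Qed.

Lemma algHom_factor A H R (p : algHom A H) (e : algHom A R) :
  (forall y, exists x, p x = y) -> (forall x, p x = 0 -> e x = 0) ->
  exists f : algHom H R, forall x, f (p x) = e x.
Proof.
move=> psurj pe; pose q y := sval (cid (psurj y)).
have qK y : p (q y) = y := svalP (cid (psurj y)).
have eq_e x y : p x = p y -> e x = e y.
  move=> pxy; apply/eqP; rewrite -subr_eq0 -rmorphB pe //.
  by rewrite rmorphB pxy subrr.
have fB : zmod_morphism (e \o q).
  by move=> x y /=; rewrite -rmorphB; apply: eq_e; rewrite rmorphB !qK.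
have fM : monoid_morphism (e \o q).
  split=> [|x y] /=; first by rewrite -(rmorph1 e); apply: eq_e;
    rewrite rmorph1 qK.
  by rewrite -rmorphM; apply: eq_e; rewrite rmorphM !qK.
pose f : {rmorphism H -> R} := HB.pack (e \o q)
  (GRing.isZmodMorphism.Build _ _ _ fB) (GRing.isMonoidMorphism.Build _ _ _ fM).
have fin c : f (ca_in H c) = ca_in R c.
  by rewrite -(ah_in e) /=; apply: eq_e; rewrite qK ah_in.
by exists (@AlgHom k H R f fin) => x /=; apply: eq_e; rewrite qK.
Qed.

(* By the Hilbert basis theorem the relations between the generators s live   *)
(* in bounded degree d, and multiplicativity in degrees up to d is enough to  *)
(* preserve them.                                                             *)
Lemma bounded_extension H (s : seq H) : generates s ->
  exists2 d, (0 < d)%N & forall (R : comAlg k) (g g' : H -> R),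
    klin g -> klin g' -> g 1 = 1 -> {in pow (1 :: s) d &,
      forall a b, g a * g b = g' (a * b)} ->
  exists f : algHom H R, forall x, lspan (pow (1 :: s) d) x -> f x = g x.
Proof.
move=> sgen; have [S [x [sx Sn xgen Su]]] := free_algebra k (size s).
have [p px] := Su H s erefl.
have psurj : forall y, exists z, p z = y.
  by apply: (generates_surj (s := x)); rewrite px.
have kerI : ideal (fun z => p z = 0).
  split; first exact: rmorph0.
    by move=> y z yI zI; rewrite rmorphD yI zI addr0.
  by move=> a y yI; rewrite rmorphM yI mulr0.
have [r rI rgen] := Sn _ kerI.
(* One degree [d] holds all generators of the relations. It is taken positive so that the elements
   of [s] themselves lie in degree [d]. *)
have [d [d1 rd]] : exists d,
    (0 < d)%N /\ {in r, forall z, lspan (pow (1 :: x) d) z}.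
  elim: (r) => [|z r' [d [d1 rd]]]; first by exists 1.
  have [i zi] := generates_pow xgen z.
  exists (maxn i d); split; first by rewrite leq_max d1 orbT.
  move=> y; rewrite inE => /orP[/eqP ->|yr].
    exact: lspan_pow_mono (leq_maxl _ _) zi.
  exact: lspan_pow_mono (leq_maxr _ _) (rd y yr).
have p1 : [seq p z | z <- 1 :: x] = 1 :: s by rewrite /= rmorph1 px.
have p_pow z i : z \in pow (1 :: x) i -> p z \in pow (1 :: s) i.
  by move=> zi; rewrite -p1 -pow_map map_f.
exists d => // R g g' gL g'L g1 gM.
have [e ex] := Su R [seq g y | y <- s] (size_map _ _).
have ex1 y : y \in 1 :: x -> e y = g (p y).
  rewrite inE => /orP[/eqP ->|yx]; first by rewrite !rmorph1 g1.
  move: ex; rewrite -px -map_comp => /eq_in_map; exact.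
have one_d : 1 \in pow (1 :: s) d.
  by apply: (pow_mono (mem_head _ _) (leq0n d)); rewrite inE.
have epow i y : (i <= d)%N -> y \in pow (1 :: x) i -> e y = g (p y).
  elim: i y => [|i IH] y id.
    by rewrite inE => /eqP ->; rewrite !rmorph1 g1.
  move=> yi; have := yi; move=> /allpairsP[[a b] /= [ax bi yab]].
  have psub j z : (j <= d)%N -> z \in pow (1 :: x) j -> p z \in pow (1 :: s) d.
    by move=> jd zj; apply: (pow_mono (mem_head _ _) jd); apply: p_pow.
  have a1 : a \in pow (1 :: x) 1 by rewrite -[a]mulr1; apply: mem_prods;
    rewrite ?inE.
  rewrite yab rmorphM ex1 // (IH b) ?(ltnW id) // gM; first last.
  - exact: psub (ltnW id) bi.
  - exact: psub d1 a1.
  (* As [g 1 = 1], the hypothesis with first factor 1 shows that [g'] agrees with [g] on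
     [pow (1 :: s) d]. *)
  rewrite -[g (p (a * b))]mul1r -{1}g1 gM ?mul1r ?rmorphM //.
  by rewrite -rmorphM -yab; apply: psub id yi.
have eL := klin_alg e; have gpL := klin_comp gL (klin_alg p).
have espan y : lspan (pow (1 :: x) d) y -> e y = g (p y).
  move=> yd; apply: (yd (fun y => e y = g (p y)));
    first exact: subspace_eq eL gpL.
  by move=> z zd; apply: epow zd.
have eker z : p z = 0 -> e z = 0.
  move=> pz; apply: (rgen z pz (fun z => e z = 0)); last first.
    by move=> y yr; rewrite espan; [rewrite rI // klin0|apply: rd].
  split; first exact: rmorph0.
    by move=> y y' yI y'I; rewrite rmorphD yI y'I addr0.
  by move=> a y yI; rewrite rmorphM yI mulr0.
have [f fp] := algHom_factor psurj eker.
exists f => y yd; apply: (yd (fun y => f y = g y)).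
  exact: subspace_eq (klin_alg f) gL.
move=> z; rewrite -p1 -pow_map => /mapP[w wd ->].
by rewrite fp (epow d).
Qed.

End Powers.

(** * Points, comodules and subcoalgebras *)

Section Points.
Variables (k : fieldType) (G : groupFunctor k) (H : comAlg k) (u : G H).
Hypothesis uP : represents u.
Implicit Types R S : comAlg k.

Lemma point_hom R (x : G R) : exists f : algHom H R, gf_map f u = x.
Proof. by have [g _ gK] := uP R; exists (g x). Qed.

(* ev x h is the value at the point x of h, seen as a function on G.          *)
Definition ev R (x : G R) : algHom H R := sval (cid (point_hom x)).

Lemma ev_gen R (x : G R) : gf_map (ev x) u = x.
Proof. exact: svalP (cid (point_hom x)). Qed.

Lemma ev_of R (f : algHom H R) : ev (gf_map f u) = f.
Proof. exact: bij_inj (uP R) _ _ (ev_gen _). Qed.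

Lemma ev_inj R (x y : G R) : ev x =1 ev y -> x = y.
Proof. by move=> /algHomP xy; rewrite -(ev_gen x) xy ev_gen. Qed.

Lemma ev_map R S (t : algHom R S) (x : G R) h : ev (gf_map t x) h = t (ev x h).
Proof. by rewrite -{1}(ev_gen x) -gf_map_comp ev_of. Qed.

Lemma ev_univ h : ev u h = h.
Proof. by rewrite -{1}(gf_map_id u) ev_of. Qed.

Lemma gf_map1 R S (t : algHom R S) : gf_map t (1%g : G R) = 1%g.
Proof.
by apply: (mulgI (gf_map t (1%g : G R))); rewrite -gf_mapM !mulg1.
Qed.

Definition structure_hom R : algHom (base_alg k) R :=
  @AlgHom k (base_alg k) R (ca_in R) (fun _ => erefl).

Definition counit (h : H) : base_alg k := ev (1%g : G (base_alg k)) h.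

Lemma ev1 R h : ev (1%g : G R) h = ca_in R (counit h).
Proof. by rewrite -(gf_map1 (structure_hom R)) ev_map. Qed.

(** The sum is found once, for the product of the two generic points over H (x) H. Any pair of
    points over any [R] is the image of that pair under one homomorphism. *)
Lemma comultiplication h : exists t : seq (H * H),
  forall R (x y : G R), ev (x * y)%g h = \sum_(p <- t) ev x p.1 * ev y p.2.
Proof.
pose l := tinl H H; pose r := tinr H H.
have [t te] := tensor_decomp (ev (gf_map l u * gf_map r u)%g h).
exists t => R x y.
have [g [gl gr]] := tensor_univ (ev x) (ev y).
have -> : x = gf_map g (gf_map l u).
  by rewrite -gf_map_comp -{1}(ev_gen x); congr (gf_map _ u); apply: algHomP =>
    a /=; rewrite gl.
have -> : y = gf_map g (gf_map r u).
  by rewrite -gf_map_comp -{1}(ev_gen y); congr (gf_map _ u); apply: algHomP =>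
    a /=; rewrite gr.
rewrite -gf_mapM ev_map te rmorph_sum; apply: eq_bigr => p _.
by rewrite rmorphM !ev_map !ev_univ.
Qed.

(* Evaluating at the generic point amounts to an identity in H (x) R, to      *)
(* which l (x) id may be applied.                                             *)
Lemma contract_generic R (l : H -> base_alg k) (lL : klin l) I J (r : seq I)
    (r' : seq J) (F : I -> H) (F' : J -> H) (a : I -> R) (a' : J -> R) :
  (forall S (t : algHom R S) (x : G S),
    \sum_(i <- r) ev x (F i) * t (a i) =
      \sum_(j <- r') ev x (F' j) * t (a' j)) ->
  \sum_(i <- r) ca_in R (l (F i)) * a i =
    \sum_(j <- r') ca_in R (l (F' j)) * a' j.
Proof.
move=> /(_ _ (tinr H R) (gf_map (tinl H R) u)).
have [h hD hE] := tensor_contract R lL.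
have h0 : h 0 = 0 by apply: (addrI (h 0)); rewrite -hD !addr0.
move=> /(congr1 h); rewrite !(big_morph h hD h0) => e.
have E K (s : seq K) (f : K -> H) (b : K -> R) :
    \sum_(i <- s) ca_in R (l (f i)) * b i =
    \sum_(i <- s) h (ev (gf_map (tinl H R) u) (f i) * tinr H R (b i)).
  by apply: eq_bigr => i _; rewrite -hE ev_of.
by rewrite !E.
Qed.

(** Basis vectors of a subspace of [H] stay independent over every [R]: contract with the [j]-th
    coordinate form. *)
Lemma separate_generic (s : seq H) (b : dual_basis s) R
    (a a' : 'I_(db_dim b) -> R) :
  (forall S (t : algHom R S) (x : G S),
    \sum_i ev x (db_vec b i) * t (a i) = \sum_i ev x (db_vec b i) * t (a' i)) ->
  a =1 a'.
Proof.
move=> h j; have := contract_generic (db_lin b j) h.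
by rewrite !db_pick.
Qed.

(** This is the condition that Delta(h) lies in U (x) V, expressed through values at products of
    points. *)
Definition splits (U V : H -> Prop) (h : H) : Prop :=
  exists2 t : seq (H * H), {in t, forall p, U p.1 /\ V p.2} &
    forall R (x y : G R), ev (x * y)%g h = \sum_(p <- t) ev x p.1 * ev y p.2.

Lemma splits_mono (U U' V V' : H -> Prop) h :
  (forall x, U x -> U' x) -> (forall x, V x -> V' x) ->
  splits U V h -> splits U' V' h.
Proof.
move=> UU VV [t tU te]; exists t => // p /tU [Up Vp].
by split; [apply: UU|apply: VV].
Qed.

Lemma splits1 (U V : H -> Prop) : U 1 -> V 1 -> splits U V 1.
Proof.
move=> U1 V1; exists [:: (1, 1)] => [p|R x y].
  by rewrite inE => /eqP ->.
by rewrite big_seq1 !rmorph1 mulr1.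
Qed.

Lemma splitsM (s s' t t' : seq H) x y :
  splits (lspan s) (lspan s') x -> splits (lspan t) (lspan t') y ->
  splits (lspan (prods s t)) (lspan (prods s' t')) (x * y).
Proof.
move=> [p pU pe] [q qU qe].
exists [seq (a.1 * b.1, a.2 * b.2) | a <- p, b <- q].
  move=> _ /allpairsP[[a b] /= [/pU [a1 a2] /qU [b1 b2] ->]] /=.
  split; first by apply: lspan_mul a1 b1 => c d cs dt; apply:
    lspan_mem (mem_prods cs dt).
  by apply: lspan_mul a2 b2 => c d cs dt; apply: lspan_mem (mem_prods cs dt).
move=> R z w; rewrite rmorphM pe qe big_allpairs_dep mulr_suml.
apply: eq_bigr => a _; rewrite mulr_sumr; apply: eq_bigr => b _.
by rewrite /= !rmorphM mulrACA.
Qed.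

(** * Matrices of right translation on a finite-dimensional space of functions *)

Section Coaction.
Variables (s : seq H) (b : dual_basis s).
Let v := db_vec b.
Let n := db_dim b.

(** This is Delta(v_j) = sum_i v_i (x) M_ji: row [j] of [M], evaluated at [y], holds the coordinates
    of the right translate of [v j] by [y]. *)
Definition coaction (M : 'I_n -> 'I_n -> H) : Prop :=
  forall R (x y : G R) j, ev (x * y)%g (v j) = \sum_i ev y (M j i) * ev x (v i).

Lemma coaction_exists (V : H -> Prop) : subspace V ->
  {in s, forall h, splits (lspan s) V h} ->
  exists2 M, coaction M & forall j i, V (M j i).
Proof.
move=> VS hs; have [V0 VD VZ] := VS.
have spl h : lspan s h -> splits (lspan s) V h.
  move=> hh; apply: (hh _ _ hs); split.
  - by exists [::] => // R x y; rewrite big_nil rmorph0.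
  - move=> x y [p pU pe] [q qU qe]; exists (p ++ q).
      by move=> z; rewrite mem_cat => /orP[/pU|/qU].
    by move=> R z w; rewrite rmorphD pe qe big_cat.
  - move=> c x [p pU pe]; have [_ _ lZ] := lspan_subspace s.
    exists [seq (ca_in H c * q.1, q.2) | q <- p].
      by move=> _ /mapP[q /pU [q1 q2] ->]; split=> //; apply: lZ.
    move=> R z w; rewrite rmorphM ah_in pe mulr_sumr big_map.
    by apply: eq_bigr => q _; rewrite /= rmorphM ah_in mulrA.
have /choice [t tP] : forall j, exists t : seq (H * H),
    {in t, forall p, lspan s p.1 /\ V p.2} /\ forall R (x y : G R),
      ev (x * y)%g (v j) = \sum_(p <- t) ev x p.1 * ev y p.2.
  by move=> j; have [t tU te] := spl _ (db_span b j); exists t.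
exists (fun j i => \sum_(p <- t j) ca_in H (db_coord b i p.1) * p.2);
  last first.
  move=> j i; rewrite big_seq; apply: (big_ind V) => // p /(tP j).1 [_ Vp].
  exact: VZ.
move=> R x y j; rewrite (tP j).2 big_seq.
under eq_bigr => p /(tP j).1 [/(db_expand b) pe _].
  rewrite {1}pe rmorph_sum mulr_suml.
  under eq_bigr => i _ do rewrite rmorphM ah_in.
  over.
rewrite -big_seq exchange_big; apply: eq_bigr => i _.
rewrite rmorph_sum mulr_suml; apply: eq_bigr => p _.
by rewrite rmorphM ah_in mulrAC.
Qed.

Section Matrix.
Variable M : 'I_n -> 'I_n -> H.
Hypothesis MP : coaction M.

(** Coassociativity: compare [v j] at z (x y) and at (z x) y. The order is reversed because
    translates are recorded as rows; for maps acting on row vectors it is the order of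
    composition. *)
Lemma coactionM R (x y : G R) j i :
  ev (x * y)%g (M j i) = \sum_l ev y (M j l) * ev x (M l i).
Proof.
move: i; apply: (separate_generic (b := b)) => S t z.
transitivity (ev (z * (gf_map t x * gf_map t y))%g (v j)).
  rewrite MP; apply: eq_bigr => i _.
  by rewrite -gf_mapM ev_map mulrC.
rewrite mulgA MP.
under eq_bigr => l _ do rewrite MP mulr_sumr.
rewrite exchange_big; apply: eq_bigr => i _.
rewrite rmorph_sum mulr_sumr; apply: eq_bigr => l _.
by rewrite rmorphM !ev_map mulrA mulrC.
Qed.

Lemma coaction1 R j i : ev (1%g : G R) (M j i) = (j == i)%:R.
Proof.
move: i; apply: (separate_generic (b := b)) => S t z.
transitivity (ev (z * 1)%g (v j)).
  rewrite MP; apply: eq_bigr => i _.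
  by rewrite -(gf_map1 t) ev_map mulrC.
rewrite mulg1 (bigD1 j) //= eqxx rmorph1 mulr1 big1 ?addr0 // => i ij.
by rewrite eq_sym (negPf ij) rmorph0 mulr0.
Qed.

(** Both sides are coordinates of the translate of [h] by [x], which are unique by
    [separate_generic]. The compatibility of translations with the structure on C and D is checked
    through this lemma. *)
Lemma coaction_coords R (x : G R) h (hs : lspan s h) (r : 'I_n -> R) :
  (forall S (t : algHom R S) (z : G S),
    ev (z * gf_map t x)%g h = \sum_i ev z (v i) * t (r i)) ->
  forall i, \sum_j ca_in R (db_coord b j h) * ev x (M j i) = r i.
Proof.
move=> hr; apply: (separate_generic (b := b)) => S t z.
rewrite -hr [in RHS](db_expand b hs) rmorph_sum.
under eq_bigr => i _ do rewrite rmorph_sum mulr_sumr.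
rewrite exchange_big; apply: eq_bigr => j _.
rewrite rmorphM ah_in MP mulr_sumr; apply: eq_bigr => i _.
by rewrite rmorphM ah_in ev_map mulrCA (mulrC (ev z _)).
Qed.

Lemma coaction_counit j : v j = \sum_i ca_in H (counit (v i)) * M j i.
Proof.
rewrite -[LHS]ev_univ -[u]mul1g MP; apply: eq_bigr => i _.
by rewrite ev_univ ev1 mulrC.
Qed.

End Matrix.
End Coaction.

(** Write Delta(h) as a sum of a_l (x) b_l with independent b_l. The a_l span a space containing h;
    comparing h at (x y) z and at x (y z) along the b_l shows that Delta(a_l) has its first factors
    among the a_m. *)
Lemma locally_finite h : exists2 s : seq H, lspan s h &
  {in s, forall g, splits (lspan s) (fun=> True) g}.
Proof.
have [t te] := comultiplication h.
have [b] := dual_basis_exists (unzip2 t).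
pose n := db_dim b.
pose a (l : 'I_n) := \sum_(p <- t) ca_in H (db_coord b l p.2) * p.1.
have ha R (x y : G R) : ev (x * y)%g h = \sum_l ev x (a l) * ev y (db_vec b l).
  rewrite te big_seq.
  under eq_bigr => p pt.
    rewrite {1}[p.2](db_expand b) ?rmorph_sum ?mulr_sumr; last first.
      by apply: lspan_mem; apply: map_f.
    under eq_bigr => i _ do rewrite rmorphM ah_in.
    over.
  rewrite -big_seq exchange_big; apply: eq_bigr => i _.
  rewrite rmorph_sum mulr_suml; apply: eq_bigr => p _.
  by rewrite rmorphM ah_in mulrA [ev x p.1 * _]mulrC.
clearbody a; pose s := [seq a l | l : 'I_n].
have sa l : lspan s (a l) by apply: lspan_mem; apply: image_f.
exists s.
  rewrite -[h]ev_univ -[u]mulg1 ha.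
  under eq_bigr => l _ do rewrite ev_univ ev1 mulrC.
  by apply: (subspace_sum (P := lspan s)) => //; exact: lspan_subspace.
have /choice [c cP] := fun m : 'I_n => comultiplication (db_vec b m).
move=> _ /imageP[l _ ->].
exists [seq (a m, \sum_(p <- c m) ca_in H (db_coord b l p.2) * p.1) | m : 'I_n].
  by move=> _ /imageP[m _ ->]; split=> //; apply: sa.
move=> R x y; rewrite big_image.
pose r' := [seq (m, p) | m <- index_enum 'I_n, p <- c m].
(* The [l]-th coordinate form, applied in the variable [z] below, isolates the value of [a l] at
   [x * y]. *)
have := @contract_generic R _ (db_lin b l) _ _ (index_enum 'I_n) r'
  (fun i => db_vec b i) (fun q => q.2.2) (fun i => ev (x * y)%g (a i))
  (fun q => ev x (a q.1) * ev y q.2.1).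
rewrite db_pick => ->.
- rewrite big_allpairs_dep; apply: eq_bigr => m _ /=.
  rewrite rmorph_sum mulr_sumr; apply: eq_bigr => p _.
  by rewrite rmorphM ah_in mulrCA.
- move=> S f z; transitivity (ev ((gf_map f x * gf_map f y) * z)%g h).
    rewrite ha; apply: eq_bigr => m _.
    by rewrite -gf_mapM ev_map mulrC.
  rewrite -mulgA ha big_allpairs_dep; apply: eq_bigr => m _ /=.
  rewrite cP mulr_sumr; apply: eq_bigr => p _.
  by rewrite rmorphM !ev_map mulrA mulrC.
Qed.

Definition subcoalgebra (s : seq H) : Prop :=
  {in s, forall g, splits (lspan s) (lspan s) g}.

(* The matrix coefficients of a finite-dimensional comodule containing h.     *)
Lemma in_subcoalgebra h : exists2 s : seq H, lspan s h & subcoalgebra s.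
Proof.
have [s0 hs0 hs] := locally_finite h.
have [b] := dual_basis_exists s0.
have [|M MP _] := coaction_exists b _ hs; first by split.
pose s := [seq M q.1 q.2 | q : 'I_(db_dim b) * 'I_(db_dim b)].
have sM j i : lspan s (M j i).
  by apply: lspan_mem; apply/imageP; exists (j, i).
exists s.
  apply: (lspan_trans _ (s := [seq db_vec b i | i : 'I_(db_dim b)])).
    move=> _ /imageP[j _ ->]; rewrite (coaction_counit MP j).
    by apply: (subspace_sum (P := lspan s)) => //; exact: lspan_subspace.
  rewrite (db_expand b hs0).
  apply: (subspace_sum (P := lspan _)) => [|i]; first exact: lspan_subspace.
  by apply: lspan_mem; apply: image_f.
move=> _ /imageP[[j i] _ ->] /=.
exists [seq (M l i, M j l) | l : 'I_(db_dim b)].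
  by move=> _ /imageP[l _ ->]; split; apply: sM.
move=> R x y; rewrite (coactionM MP) big_image; apply: eq_bigr => l _.
by rewrite mulrC.
Qed.

Lemma in_subcoalgebra_seq (g : seq H) :
  exists2 s : seq H, {in g, forall h, lspan s h} & subcoalgebra s.
Proof.
elim: g => [|h g [s gs ss]]; first by exists [::].
have [s' hs' ss'] := in_subcoalgebra h.
have l x : lspan s x -> lspan (s' ++ s) x.
  by apply: lspan_sub => y ys; rewrite mem_cat ys orbT.
have l' x : lspan s' x -> lspan (s' ++ s) x.
  by apply: lspan_sub => y ys; rewrite mem_cat ys.
exists (s' ++ s) => x.
  by rewrite inE => /orP[/eqP ->|/gs]; [apply: l'|apply: l].
by rewrite mem_cat => /orP[/ss'|/ss]; apply: splits_mono.
Qed.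

Lemma subcoalgebra_pow (s : seq H) d :
  subcoalgebra s -> subcoalgebra (pow (1 :: s) d).
Proof.
move=> ss; have ss1 : subcoalgebra (1 :: s).
  have l x : lspan s x -> lspan (1 :: s) x.
    by apply: lspan_sub => y ys; rewrite inE ys orbT.
  have l1 : lspan (1 :: s) 1 by apply: lspan_mem; apply: mem_head.
  move=> x; rewrite inE => /orP[/eqP ->|/ss]; first exact: splits1.
  exact: splits_mono.
elim: d => [|d IH] x.
  have l1 : lspan [:: 1 : H] 1 by apply: lspan_mem; apply: mem_head.
  by rewrite inE => /eqP ->; apply: splits1.
by move=> /allpairsP[[a b] /= [/ss1 sa /IH sb ->]]; apply: splitsM.
Qed.

Lemma generates_span (g s : seq H) :
  generates g -> {in g, forall h, lspan s h} -> generates s.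
Proof.
move=> gg gs P Pk Ps PD PM; apply: gg => // x /gs; apply=> //.
split=> //; first by rewrite -(rmorph0 (ca_in H)).
by move=> c y; apply: PM.
Qed.

(** Take the products of [d] factors from 1 and a generating subcoalgebra, with [d] from
    [bounded_extension]. They span a subcoalgebra again, since Delta is multiplicative, and the
    products of pairs of them detect every relation of [H]. *)
Lemma quadratic_subcoalgebra : finitely_generated H -> exists s : seq H,
  [/\ subcoalgebra s, 1 \in s, generates s &
    forall R (g g' : H -> R), klin g -> klin g' -> g 1 = 1 ->
      (forall a b, lspan s a -> lspan s b -> g a * g b = g' (a * b)) ->
      exists f : algHom H R, forall x, lspan s x -> f x = g x].
Proof.
move=> [g gg]; have [s gs ss] := in_subcoalgebra_seq g.
have sg := generates_span gg gs.
have [d d0 dP] := bounded_extension sg.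
exists (pow (1 :: s) d); split.
- exact: subcoalgebra_pow.
- by apply: (pow_mono (mem_head _ _) (leq0n d)); rewrite inE.
- apply: generates_span sg _ => x xs; apply: (lspan_pow_mono d0).
  apply: lspan_mem; rewrite -[x]mulr1.
  by apply: mem_prods; rewrite inE ?xs ?orbT.
- move=> R h h' hL h'L h1 hM; apply: dP hL h'L h1 _ => a b ad bd.
  by apply: hM; apply: lspan_mem.
Qed.

End Points.

(** * The algebra attached to a subcoalgebra *)

Lemma row_mulmx_inj (R : pzRingType) m n (A B : 'M[R]_(m, n)) :
  (forall v : 'rV_m, v *m A = v *m B) -> A = B.
Proof. by move=> AB; apply/row_matrixP => i; rewrite !rowE. Qed.

Lemma linear_fun_sum (R : pzRingType) (U V : lmodType R) (f : U -> V)
    (fL : linear f) I (r : seq I) (F : I -> U) (c : I -> R) :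
  f (\sum_(i <- r) c i *: F i) = \sum_(i <- r) c i *: f (F i).
Proof.
pose F' : {linear U -> V} := HB.pack f (GRing.isLinear.Build _ _ _ *:%R _ fL).
rewrite -[f _]/(F' _) linear_sum; apply: eq_bigr => i _.
exact: (linearZ_LR F').
Qed.

Lemma scalar_cancel (k : fieldType) (R : comAlg k) (V : lmodType R) (c d : k)
    (v : V) : c != d -> ca_in R c *: v = ca_in R d *: v -> v = 0.
Proof.
rewrite -subr_eq0 => cd /eqP; rewrite -subr_eq0 -scalerBl -rmorphB => /eqP e.
rewrite -[v]scale1r -(rmorph1 (ca_in R)) -(mulVf cd) rmorphM -scalerA e.
exact: scaler0.
Qed.

(* The algebra has underlying space k e + k u + W + C + D; here W and C are   *)
(* copies of k^n and D is a copy of k^m.  The vector e is a right identity,   *)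
(* and left multiplication by e acts on the summands as 1, al, be, ga, de.    *)
(* Moreover u u = u + w_0 + o with o in C, u w_i = w_(i+1), w_i c = c L_i for *)
(* c in C, the product of C with itself is a bilinear map to D with matrices  *)
(* T_i, and all other products vanish.  An automorphism fixes e, hence        *)
(* respects the summands, hence fixes u, all the w_i, and o.                  *)
Section SortedAlgebra.
Variables (k : fieldType) (n m : nat).
Variables (al be ga de : k).
Variables (L : 'I_n -> 'M[k]_n) (T : 'I_n -> 'M[k]_(n, m)) (o : 'rV[k]_n).

Section OverR.
Variable R : comAlg k.

Local Notation cst := (ca_in R).
Local Notation mx := (map_mx (ca_in R)).

(* The components are the coordinates at e, u and the parts in W, C, D.       *)
Definition smod : Type := (R^o * R^o * 'rV[R]_n * 'rV[R]_n * 'rV[R]_m)%type.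
HB.instance Definition _ := GRing.Lmodule.on smod.

Implicit Types x y z : smod.

Definition pe x : R := x.1.1.1.1.
Definition pu x : R := x.1.1.1.2.
Definition pw x : 'rV[R]_n := x.1.1.2.
Definition pc x : 'rV[R]_n := x.1.2.
Definition pd x : 'rV[R]_m := x.2.
Definition mk (a b : R) (w c : 'rV[R]_n) (d : 'rV[R]_m) : smod :=
  (a, b, w, c, d).

Lemma smod_eq x y :
  pe x = pe y -> pu x = pu y -> pw x = pw y -> pc x = pc y -> pd x = pd y ->
    x = y.
Proof.
move: x y => [[[[a b] w] c] d] [[[[a' b'] w'] c'] d'].
by rewrite /pe /pu /pw /pc /pd /= => -> -> -> -> ->.
Qed.

(** Multiplying a row by this matrix on the right sends the basis vector of index i to that of index
    i+1, and the last one to 0. *)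
Definition shift_mx : 'M[R]_n := \matrix_(i, j) (j == i.+1 :> nat)%:R.
Definition first_row : 'rV[R]_n := \row_j (j == 0 :> nat)%:R.

Definition actW (w c : 'rV[R]_n) : 'rV[R]_n := \sum_i w 0 i *: (c *m mx (L i)).
Definition mulC (c c' : 'rV[R]_n) : 'rV[R]_m :=
  \sum_i c 0 i *: (c' *m mx (T i)).

Definition amul x y : smod :=
  mk (pe y * pe x)
     (pe y * pu x + pe x * (cst al * pu y) + pu x * pu y)
     (pe y *: pw x + pe x *: (cst be *: pw y) +
        pu x *: (pu y *: first_row) + pu x *: (pw y *m shift_mx))
     (pe y *: pc x + pe x *: (cst ga *: pc y) +
        pu x *: (pu y *: mx o) + actW (pw x) (pc y))
     (pe y *: pd x + pe x *: (cst de *: pd y) + mulC (pc x) (pc y)).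

Lemma actW_linearl c : linear (actW^~ c).
Proof.
move=> a w w'; rewrite /actW scaler_sumr -big_split; apply: eq_bigr => i _ /=.
by rewrite !mxE scalerDl scalerA.
Qed.

Lemma actW_linearr w : linear (actW w).
Proof.
move=> a c c'; rewrite /actW scaler_sumr -big_split; apply: eq_bigr => i _ /=.
by rewrite mulmxDl scalerDr -scalemxAl scalerA mulrC -scalerA.
Qed.

Lemma mulC_linearl c : linear (mulC^~ c).
Proof.
move=> a w w'; rewrite /mulC scaler_sumr -big_split; apply: eq_bigr => i _ /=.
by rewrite !mxE scalerDl scalerA.
Qed.

Lemma mulC_linearr w : linear (mulC w).
Proof.
move=> a c c'; rewrite /mulC scaler_sumr -big_split; apply: eq_bigr => i _ /=.
by rewrite mulmxDl scalerDr -scalemxAl scalerA mulrC -scalerA.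
Qed.

Lemma actW_delta i c : actW (delta_mx 0 i) c = c *m mx (L i).
Proof.
rewrite /actW (bigD1 i) //= mxE !eqxx scale1r big1 ?addr0 // => j ji.
by rewrite mxE (negPf ji) andbF scale0r.
Qed.

Lemma mulC_delta i c : mulC (delta_mx 0 i) c = c *m mx (T i).
Proof.
rewrite /mulC (bigD1 i) //= mxE !eqxx scale1r big1 ?addr0 // => j ji.
by rewrite mxE (negPf ji) andbF scale0r.
Qed.

Lemma pe_lin a x y : pe (a *: x + y) = a * pe x + pe y. Proof. by []. Qed.
Lemma pu_lin a x y : pu (a *: x + y) = a * pu x + pu y. Proof. by []. Qed.
Lemma pw_lin a x y : pw (a *: x + y) = a *: pw x + pw y. Proof. by []. Qed.
Lemma pc_lin a x y : pc (a *: x + y) = a *: pc x + pc y. Proof. by []. Qed.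
Lemma pd_lin a x y : pd (a *: x + y) = a *: pd x + pd y. Proof. by []. Qed.

Lemma pe_amul x y : pe (amul x y) = pe y * pe x.
Proof. by []. Qed.

Lemma pu_amul x y :
  pu (amul x y) = pe y * pu x + pe x * (cst al * pu y) + pu x * pu y.
Proof. by []. Qed.

Lemma pw_amul x y : pw (amul x y) = pe y *: pw x + pe x *: (cst be *: pw y) +
  pu x *: (pu y *: first_row) + pu x *: (pw y *m shift_mx).
Proof. by []. Qed.

Lemma pc_amul x y : pc (amul x y) = pe y *: pc x + pe x *: (cst ga *: pc y) +
  pu x *: (pu y *: mx o) + actW (pw x) (pc y).
Proof. by []. Qed.

Lemma pd_amul x y : pd (amul x y) = pe y *: pd x + pe x *: (cst de *: pd y) +
  mulC (pc x) (pc y).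
Proof. by []. Qed.

Definition amulE := (pe_amul, pu_amul, pw_amul, pc_amul, pd_amul).
Opaque amul.

Definition linE := (pe_lin, pu_lin, pw_lin, pc_lin, pd_lin).
Definition smodE := (linE, amulE).

Lemma amul_linearl y : linear (amul^~ y).
Proof.
move=> a x x' /=; apply: smod_eq.
- by rewrite !smodE mulrDr mulrCA.
- rewrite !smodE.
  rewrite !mulrDr !mulrDl [RHS]addrACA; congr (_ + _); last by rewrite mulrA.
  by rewrite [RHS]addrACA; congr (_ + _); rewrite ?mulrA // [pe y * a]mulrC.
- rewrite !smodE.
  rewrite !scalerDr !scalerDl [RHS]addrACA; congr (_ + _);
    last by rewrite !scalerA.
  rewrite [RHS]addrACA; congr (_ + _); last by rewrite !scalerA mulrA.
  by rewrite [RHS]addrACA; congr (_ + _);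
    rewrite ?scalerA ?mulrA // [pe y * a]mulrC.
- rewrite !smodE.
  rewrite actW_linearl !scalerDr !scalerDl [RHS]addrACA; congr (_ + _).
  rewrite [RHS]addrACA; congr (_ + _); last by rewrite !scalerA mulrA.
  by rewrite [RHS]addrACA; congr (_ + _);
    rewrite ?scalerA ?mulrA // [pe y * a]mulrC.
- rewrite !smodE.
  rewrite mulC_linearl !scalerDr !scalerDl [RHS]addrACA; congr (_ + _).
  by rewrite [RHS]addrACA; congr (_ + _);
    rewrite ?scalerA ?mulrA // [pe y * a]mulrC.
Qed.

Lemma amul_linearr x : linear (amul x).
Proof.
move=> a y y' /=; apply: smod_eq.
- by rewrite !smodE mulrDl mulrA.
- rewrite !smodE.
  rewrite mulrDl (mulrDr (cst al)) (mulrDr (pe x)) (mulrDr (pu x)) mulrDr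
    mulrDr.
  rewrite [RHS]addrACA; congr (_ + _); last by rewrite (mulrCA a).
  by rewrite [RHS]addrACA; congr (_ + _); rewrite !mulrA // (mulrC _ a) !mulrA.
- rewrite !smodE.
  rewrite mulmxDl -scalemxAl !scalerDl !scalerDr [RHS]addrACA; congr (_ + _).
    rewrite [RHS]addrACA; congr (_ + _); last by rewrite !scalerA mulrCA mulrA.
    rewrite [RHS]addrACA; congr (_ + _); rewrite !scalerA // mulrA.
    by rewrite (mulrC _ a) mulrA.
  by rewrite !scalerA mulrC.
- rewrite !smodE.
  rewrite actW_linearr !scalerDl !scalerDr [RHS]addrACA; congr (_ + _).
  rewrite [RHS]addrACA; congr (_ + _); last by rewrite !scalerA mulrCA mulrA.
  rewrite [RHS]addrACA; congr (_ + _); rewrite !scalerA // mulrA.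
  by rewrite (mulrC _ a) mulrA.
- rewrite !smodE.
  rewrite mulC_linearr !scalerDl !scalerDr [RHS]addrACA; congr (_ + _).
  rewrite [RHS]addrACA; congr (_ + _); rewrite !scalerA // mulrA.
  by rewrite (mulrC _ a) mulrA.
Qed.

Definition eE : smod := mk 1 0 0 0 0.
Definition eU b : smod := mk 0 b 0 0 0.
Definition eW w : smod := mk 0 0 w 0 0.
Definition eC c : smod := mk 0 0 0 c 0.
Definition eD d : smod := mk 0 0 0 0 d.

Lemma peE a b w c d : pe (mk a b w c d) = a. Proof. by []. Qed.
Lemma puE a b w c d : pu (mk a b w c d) = b. Proof. by []. Qed.
Lemma pwE a b w c d : pw (mk a b w c d) = w. Proof. by []. Qed.
Lemma pcE a b w c d : pc (mk a b w c d) = c. Proof. by []. Qed.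
Lemma pdE a b w c d : pd (mk a b w c d) = d. Proof. by []. Qed.
Lemma peD x y : pe (x + y) = pe x + pe y. Proof. by []. Qed.
Lemma puD x y : pu (x + y) = pu x + pu y. Proof. by []. Qed.
Lemma pwD x y : pw (x + y) = pw x + pw y. Proof. by []. Qed.
Lemma pcD x y : pc (x + y) = pc x + pc y. Proof. by []. Qed.
Lemma pdD x y : pd (x + y) = pd x + pd y. Proof. by []. Qed.
Lemma peZ a x : pe (a *: x) = a * pe x. Proof. by []. Qed.
Lemma puZ a x : pu (a *: x) = a * pu x. Proof. by []. Qed.
Lemma pwZ a x : pw (a *: x) = a *: pw x. Proof. by []. Qed.
Lemma pcZ a x : pc (a *: x) = a *: pc x. Proof. by []. Qed.
Lemma pdZ a x : pd (a *: x) = a *: pd x. Proof. by []. Qed.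

Definition mkE := (peE, puE, pwE, pcE, pdE).
Definition mkDZ := (peD, puD, pwD, pcD, pdD, peZ, puZ, pwZ, pcZ, pdZ).

Lemma actW0l c : actW 0 c = 0.
Proof. by apply: big1 => i _; rewrite mxE scale0r. Qed.
Lemma actW0r w : actW w 0 = 0.
Proof. by apply: big1 => i _; rewrite mul0mx scaler0. Qed.
Lemma mulC0l c : mulC 0 c = 0.
Proof. by apply: big1 => i _; rewrite mxE scale0r. Qed.
Lemma mulC0r w : mulC w 0 = 0.
Proof. by apply: big1 => i _; rewrite mul0mx scaler0. Qed.

Definition simpE := (actW0l, actW0r, mulC0l, mulC0r, mulr0, mul0r, mulr1, mul1r,
  scaler0, scale0r, scale1r, mul0mx, addr0, add0r).

Lemma smod_decomp x :
  x = pe x *: eE + eU (pu x) + eW (pw x) + eC (pc x) + eD (pd x).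
Proof. by apply: smod_eq; rewrite !mkDZ !mkE ?simpE. Qed.

Lemma amul_eE x : amul eE x =
  mk (pe x) (cst al * pu x) (cst be *: pw x) (cst ga *: pc x) (cst de *: pd x).
Proof. by apply: smod_eq; rewrite !amulE !mkE !simpE. Qed.

Lemma amulx_eE x : amul x eE = x.
Proof. by apply: smod_eq; rewrite !amulE !mkE !simpE. Qed.

Lemma amul_eU a b :
  amul (eU a) (eU b) =
    eU (a * b) + eW (a * b *: first_row) + eC (a * b *: mx o).
Proof. by apply: smod_eq; rewrite !amulE !mkDZ !mkE !simpE ?scalerA. Qed.

Lemma amul_eUW w : amul (eU 1) (eW w) = eW (w *m shift_mx).
Proof. by apply: smod_eq; rewrite !amulE !mkE !simpE. Qed.

Lemma amul_eWC w c : amul (eW w) (eC c) = eC (actW w c).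
Proof. by apply: smod_eq; rewrite !amulE !mkE !simpE. Qed.

Lemma amul_eCC c c' : amul (eC c) (eC c') = eD (mulC c c').
Proof. by apply: smod_eq; rewrite !amulE !mkE !simpE. Qed.

Lemma eU_scale a b : eU (a * b) = a *: eU b.
Proof. by apply: smod_eq; rewrite !mkDZ !mkE ?simpE. Qed.
Lemma eW_linear : linear eW.
Proof. by move=> a w w'; apply: smod_eq; rewrite !mkDZ !mkE ?simpE. Qed.
Lemma eC_linear : linear eC.
Proof. by move=> a c c'; apply: smod_eq; rewrite !mkDZ !mkE ?simpE. Qed.
Lemma eD_linear : linear eD.
Proof. by move=> a d d'; apply: smod_eq; rewrite !mkDZ !mkE ?simpE. Qed.

Definition blk (P : 'M[R]_n) (Q : 'M[R]_m) x : smod :=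
  mk (pe x) (pu x) (pw x) (pc x *m P) (pd x *m Q).

(** The conditions come from the products W C, C C and u u; [blk_amul] proves them sufficient for
    [blk P Q] to be multiplicative, and [smod_automorphism] proves that every automorphism arises
    from such blocks. *)
Definition compatible (P : 'M[R]_n) (Q : 'M[R]_m) : Prop :=
  [/\ forall i, mx (L i) *m P = P *m mx (L i),
      forall c c', mulC (c *m P) (c' *m P) = mulC c c' *m Q &
      mx o *m P = mx o].

Lemma pe_blk P Q x : pe (blk P Q x) = pe x. Proof. by []. Qed.
Lemma pu_blk P Q x : pu (blk P Q x) = pu x. Proof. by []. Qed.
Lemma pw_blk P Q x : pw (blk P Q x) = pw x. Proof. by []. Qed.
Lemma pc_blk P Q x : pc (blk P Q x) = pc x *m P. Proof. by []. Qed.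
Lemma pd_blk P Q x : pd (blk P Q x) = pd x *m Q. Proof. by []. Qed.
Definition blkE := (pe_blk, pu_blk, pw_blk, pc_blk, pd_blk).
Opaque blk.

Lemma blk_linear P Q : linear (blk P Q).
Proof.
by move=> a x y; apply: smod_eq; rewrite !(linE, blkE) ?mulmxDl ?scalemxAl.
Qed.

Lemma blk_amul P Q : compatible P Q -> {morph blk P Q : x y / amul x y}.
Proof.
move=> [PL PQ Po] x y; apply: smod_eq; rewrite !(blkE, amulE) //.
  rewrite !mulmxDl -!scalemxAl Po; congr (_ + _).
  rewrite /actW mulmx_suml; apply: eq_bigr => i _.
  by rewrite -scalemxAl -!mulmxA PL.
by rewrite !mulmxDl -!scalemxAl PQ.
Qed.

(** * Automorphisms of the algebra over an arbitrary base ring *)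

Section Automorphism.
Hypothesis eigs : uniq [:: 0; 1; al; be; ga; de].
Variable g : {linear smod -> smod}.
Hypothesis g_bij : bijective g.
Hypothesis gM : {morph g : x y / amul x y}.

Let g_surj y : exists x, g x = y.
Proof. by case: g_bij => h _ hK; exists (h y). Qed.

Let neq i j : (i < 6)%N -> (j < 6)%N -> i != j ->
  nth 0 [:: 0; 1; al; be; ga; de] i != nth 0 [:: 0; 1; al; be; ga; de] j.
Proof. by move=> i6 j6; rewrite nth_uniq. Qed.

(** By surjectivity e = g(x) for some x, and x e = x gives e g(e) = e. Left multiplication by e is
    diagonal with nonzero eigenvalues and fixes e, so g(e) = e. *)
Let g_e : g eE = eE.
Proof.
have : amul eE (g eE) = eE.
  by have [x gx] := g_surj eE; rewrite -{1}gx -gM amulx_eE.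
rewrite amul_eE => e.
have z (V : lmodType R) (c : k) (v : V) : c != 0 -> cst c *: v = 0 -> v = 0.
  by move=> c0 cv; apply: (scalar_cancel c0); rewrite cv rmorph0 scale0r.
apply: smod_eq; rewrite mkE.
- exact: (congr1 pe e).
- exact: (z R^o al _ (@neq 2 0 isT isT isT) (congr1 pu e)).
- exact: (z _ be _ (@neq 3 0 isT isT isT) (congr1 pw e)).
- exact: (z _ ga _ (@neq 4 0 isT isT isT) (congr1 pc e)).
- exact: (z _ de _ (@neq 5 0 isT isT isT) (congr1 pd e)).
Qed.


Let g_eig x lam : amul eE x = cst lam *: x -> amul eE (g x) = cst lam *: g x.
Proof. by move=> e; rewrite -{1}g_e -gM e linearZ_LR. Qed.

Let eig_eU b : amul eE (eU b) = cst al *: eU b.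
Proof. by rewrite amul_eE; apply: smod_eq; rewrite !mkDZ !mkE ?simpE. Qed.
Let eig_eW w : amul eE (eW w) = cst be *: eW w.
Proof. by rewrite amul_eE; apply: smod_eq; rewrite !mkDZ !mkE ?simpE. Qed.
Let eig_eC c : amul eE (eC c) = cst ga *: eC c.
Proof. by rewrite amul_eE; apply: smod_eq; rewrite !mkDZ !mkE ?simpE. Qed.
Let eig_eD d : amul eE (eD d) = cst de *: eD d.
Proof. by rewrite amul_eE; apply: smod_eq; rewrite !mkDZ !mkE ?simpE. Qed.

(** A nonzero difference of eigenvalues in [k] is a unit in [R], so eigenspaces separate even when
    [R] has zero divisors. *)
Let eig_components x lam : amul eE x = cst lam *: x ->
  [/\ 1 != lam -> pe x = 0, al != lam -> pu x = 0, be != lam -> pw x = 0,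
      ga != lam -> pc x = 0 & de != lam -> pd x = 0].
Proof.
rewrite amul_eE => e; split=> ne.
- apply: (@scalar_cancel _ R R^o _ _ _ ne); rewrite rmorph1 scale1r.
  exact: (congr1 pe e).
- exact: (@scalar_cancel _ R R^o _ _ _ ne (congr1 pu e)).
- exact: (scalar_cancel ne (congr1 pw e)).
- exact: (scalar_cancel ne (congr1 pc e)).
- exact: (scalar_cancel ne (congr1 pd e)).
Qed.

Let g_eU b : g (eU b) = eU (pu (g (eU b))).
Proof.
have [h1 _ h3 h4 h5] := eig_components (g_eig (eig_eU b)).
apply: smod_eq; rewrite mkE //.
- exact: h1 (@neq 1 2 isT isT isT).
- exact: h3 (@neq 3 2 isT isT isT).
- exact: h4 (@neq 4 2 isT isT isT).
- exact: h5 (@neq 5 2 isT isT isT).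
Qed.

Let g_eW w : g (eW w) = eW (pw (g (eW w))).
Proof.
have [h1 h2 _ h4 h5] := eig_components (g_eig (eig_eW w)).
apply: smod_eq; rewrite mkE //.
- exact: h1 (@neq 1 3 isT isT isT).
- exact: h2 (@neq 2 3 isT isT isT).
- exact: h4 (@neq 4 3 isT isT isT).
- exact: h5 (@neq 5 3 isT isT isT).
Qed.

Let g_eC c : g (eC c) = eC (pc (g (eC c))).
Proof.
have [h1 h2 h3 _ h5] := eig_components (g_eig (eig_eC c)).
apply: smod_eq; rewrite mkE //.
- exact: h1 (@neq 1 4 isT isT isT).
- exact: h2 (@neq 2 4 isT isT isT).
- exact: h3 (@neq 3 4 isT isT isT).
- exact: h5 (@neq 5 4 isT isT isT).
Qed.

Let g_eD d : g (eD d) = eD (pd (g (eD d))).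
Proof.
have [h1 h2 h3 h4 _] := eig_components (g_eig (eig_eD d)).
apply: smod_eq; rewrite mkE //.
- exact: h1 (@neq 1 5 isT isT isT).
- exact: h2 (@neq 2 5 isT isT isT).
- exact: h3 (@neq 3 5 isT isT isT).
- exact: h4 (@neq 4 5 isT isT isT).
Qed.

Let gU b := pu (g (eU b)).
Let gW w := pw (g (eW w)).
Let gC c := pc (g (eC c)).
Let gD d := pd (g (eD d)).

Let gWL : linear gW.
Proof. by move=> a w w'; rewrite /gW eW_linear linearP pwD pwZ. Qed.
Let gCL : linear gC.
Proof. by move=> a c c'; rewrite /gC eC_linear linearP pcD pcZ. Qed.
Let gDL : linear gD.
Proof. by move=> a d d'; rewrite /gD eD_linear linearP pdD pdZ. Qed.

Let g_decomp x : g x =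
  pe x *: eE + eU (pu x * gU 1) + eW (gW (pw x)) + eC (gC (pc x)) + eD (gD (pd
    x)).
Proof.
rewrite {1}[x]smod_decomp !linearD linearZ_LR g_e g_eW g_eC g_eD.
by rewrite -[pu x in LHS]mulr1 !eU_scale linearZ_LR g_eU.
Qed.

Let gU_unit : exists z : R, z * gU 1 = 1.
Proof.
have [x gx] := g_surj (eU 1); exists (pu x).
by have := congr1 pu gx; rewrite g_decomp !mkDZ !mkE !simpE.
Qed.

Let g_UU : eU (gU 1) + eW (gW first_row) + eC (gC (mx o)) =
  eU (gU 1 * gU 1) + eW (gU 1 * gU 1 *: first_row) + eC (gU 1 * gU 1 *: mx o).
Proof.
rewrite -amul_eU -[eU (gU 1)]g_eU -gM amul_eU !linearD mulr1 !scale1r.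
by rewrite g_eU g_eW g_eC.
Qed.

(** Applying [g] to u u shows that this scalar is idempotent. That alone leaves other possibilities
    over a general [R], but by surjectivity it is also a unit. *)
Let gU1 : gU 1 = 1.
Proof.
have [z zg] := gU_unit; have := congr1 pu g_UU; rewrite !mkDZ !mkE !simpE => e.
transitivity (z * (gU 1 * gU 1)); first by rewrite mulrA zg mul1r.
by rewrite -e zg.
Qed.

Let gW_first : gW first_row = first_row.
Proof. by have := congr1 pw g_UU; rewrite gU1 !mkDZ !mkE !simpE. Qed.

Let gC_o : gC (mx o) = mx o.
Proof. by have := congr1 pc g_UU; rewrite gU1 !mkDZ !mkE !simpE. Qed.

Let gW_shift w : gW (w *m shift_mx) = gW w *m shift_mx.
Proof.
have e : g (eU 1) = eU 1 by rewrite g_eU -/(gU 1) gU1.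
by have := gM (eU 1) (eW w); rewrite e g_eW !amul_eUW g_eW => /(congr1 pw).
Qed.

Let gW_delta i : gW (delta_mx 0 i) = delta_mx 0 i.
Proof.
case: i => i; elim: i => [|i IH] lt_i.
  rewrite (_ : delta_mx 0 _ = first_row); first exact: gW_first.
  by apply/rowP => j; rewrite !mxE eqxx.
rewrite (_ : delta_mx 0 _ = delta_mx 0 (Ordinal (ltnW lt_i)) *m shift_mx).
  by rewrite gW_shift IH.
by rewrite -rowE; apply/rowP => j; rewrite !mxE eqxx.
Qed.

Let gW_id w : gW w = w.
Proof.
rewrite [w in gW w]row_sum_delta (linear_fun_sum gWL) [RHS]row_sum_delta.
by apply: eq_bigr => i _; rewrite gW_delta.
Qed.

Lemma smod_automorphism : exists P Q, compatible P Q /\ forall x, g x =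
  blk P Q x.
Proof.
pose gCl : {linear 'rV[R]_n -> 'rV[R]_n} :=
  HB.pack gC (GRing.isLinear.Build _ _ _ *:%R _ gCL).
pose gDl : {linear 'rV[R]_m -> 'rV[R]_m} :=
  HB.pack gD (GRing.isLinear.Build _ _ _ *:%R _ gDL).
have PE c : c *m lin1_mx gCl = gC c by rewrite mul_rV_lin1.
have QE d : d *m lin1_mx gDl = gD d by rewrite mul_rV_lin1.
exists (lin1_mx gCl), (lin1_mx gDl); split; last first.
  move=> x; rewrite g_decomp gU1 gW_id -PE -QE.
  by apply: smod_eq; rewrite ?blkE !mkDZ !mkE !simpE.
split; last by rewrite PE gC_o.
- move=> i; apply: row_mulmx_inj => c; rewrite !mulmxA !PE -!actW_delta.
  (* Since all w_i are fixed, multiplicativity on w_i c says that [g] commutes with [L i] on C. *)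
  have := gM (eW (delta_mx 0 i)) (eC c).
  by rewrite amul_eWC g_eW g_eC [g (eC c)]g_eC -/(gW _) gW_id amul_eWC =>
    /(congr1 pc).
- move=> c c'; rewrite !PE QE; have := gM (eC c) (eC c').
  by rewrite amul_eCC g_eD [g (eC c)]g_eC [g (eC c')]g_eC amul_eCC =>
    /(congr1 pd).
Qed.

End Automorphism.
End OverR.
End SortedAlgebra.

(** * Base change of the algebra *)

Section Recognition.
Variables (k : fieldType) (n m : nat).
Variables (al be ga de : k).
Variables (L : 'I_n -> 'M[k]_n) (T : 'I_n -> 'M[k]_(n, m)) (o : 'rV[k]_n).

Local Notation srt R := (smod n m R).
Local Notation mul R := (@amul k n m al be ga de L T o R).

Definition smod_space : vectType k :=
  (k^o * k^o * 'rV[k]_n * 'rV[k]_n * 'rV[k]_m)%type.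

Definition smod_mul (x y : smod_space) : smod_space := mul (base_alg k) x y.

Lemma smod_mul_bilinear : bilinear_for
  (GRing.Scale.Law.clone _ _ *:%R _) (GRing.Scale.Law.clone _ _
    *:%R _) smod_mul.
Proof.
split=> [y|x] a z z';
  [exact: (@amul_linearl k n m al be ga de L T o (base_alg k) y a z z')|exact:
  (@amul_linearr k n m al be ga de L T o (base_alg k) x a z z')].
Qed.

HB.instance Definition _ := bilinear_isBilinear.Build k smod_space smod_space
  smod_space *:%R *:%R smod_mul smod_mul_bilinear.

Definition smod_fda : fdAlgebra k :=
  @FdAlgebra k smod_space smod_mul.

Local Notation A := smod_fda.

Definition smod_map (R S : comAlg k) (t : {rmorphism R -> S}) (x : srt R) :
  srt S :=
  mk (t (pe x)) (t (pu x)) (map_mx t (pw x)) (map_mx t (pc x)) (map_mx t (pd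
    x)).

Section MapComponents.
Variables (R S : comAlg k) (t : {rmorphism R -> S}) (x : srt R).
Lemma pe_map : pe (smod_map t x) = t (pe x). Proof. by []. Qed.
Lemma pu_map : pu (smod_map t x) = t (pu x). Proof. by []. Qed.
Lemma pw_map : pw (smod_map t x) = map_mx t (pw x). Proof. by []. Qed.
Lemma pc_map : pc (smod_map t x) = map_mx t (pc x). Proof. by []. Qed.
Lemma pd_map : pd (smod_map t x) = map_mx t (pd x). Proof. by []. Qed.
End MapComponents.
Definition mapE := (pe_map, pu_map, pw_map, pc_map, pd_map).
Opaque smod_map.

Lemma smod_map_lin (R S : comAlg k) (t : {rmorphism R -> S}) a (x y : srt R) :
  smod_map t (a *: x + y) = t a *: smod_map t x + smod_map t y.
Proof.
by apply: smod_eq; rewrite !(mapE, linE) ?rmorphD ?rmorphM ?map_mxD ?map_mxZ.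
Qed.

Lemma map_mx_comp_in (R S : comAlg k) (t : algHom R S) p q (B : 'M[k]_(p, q)) :
  map_mx t (map_mx (ca_in R) B) = map_mx (ca_in S) B.
Proof. by rewrite -map_mx_comp; apply/matrixP => i j;
  rewrite !mxE /= ah_in. Qed.

Lemma map_first_row (R S : comAlg k) (t : {rmorphism R -> S}) :
  map_mx t (first_row n R) = first_row n S.
Proof. by apply/matrixP => i j; rewrite !mxE rmorph_nat. Qed.

Lemma map_shift_mx (R S : comAlg k) (t : {rmorphism R -> S}) :
  map_mx t (shift_mx n R) = shift_mx n S.
Proof. by apply/matrixP => i j; rewrite !mxE rmorph_nat. Qed.

Lemma smod_map_amul (R S : comAlg k) (t : algHom R S) (x y : srt R) :
  smod_map t (mul R x y) = mul S (smod_map t x) (smod_map t y).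
Proof.
apply: smod_eq; rewrite !(mapE, amulE).
- by rewrite rmorphM.
- by rewrite !rmorphD !rmorphM ah_in.
- by rewrite !map_mxD !map_mxZ map_mxM ah_in map_first_row map_shift_mx.
- rewrite !map_mxD !map_mxZ ah_in map_mx_comp_in; congr (_ + _).
  rewrite /actW raddf_sum; apply: eq_bigr => i _.
  by rewrite /= map_mxZ map_mxM map_mx_comp_in mxE.
- rewrite !map_mxD !map_mxZ ah_in; congr (_ + _).
  rewrite /mulC raddf_sum; apply: eq_bigr => i _.
  by rewrite /= map_mxZ map_mxM map_mx_comp_in mxE.
Qed.

Lemma smod_map_blk (R S : comAlg k) (t : {rmorphism R -> S}) P Q (x : srt R) :
  smod_map t (blk P Q x) = blk (map_mx t P) (map_mx t Q) (smod_map t x).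
Proof. by apply: smod_eq; rewrite !(mapE, blkE) ?map_mxM. Qed.

Section Expand.
Variable R : comAlg k.

(** The [R]-linear map with the values of [f] on the standard basis. For [f] equal to [smod_in] it
    is the identity, and for [bc_in] it is the inverse of [to_smod]. *)
Definition smod_sum (V : lmodType R) (f : smod_space -> V) (y : srt R) : V :=
  pe y *: f (eE n m (base_alg k)) + pu y *: f (eU n m (1 : base_alg k)) +
  \sum_i pw y 0 i *: f (eW m (delta_mx 0 i : 'rV[base_alg k]_n)) +
  \sum_i pc y 0 i *: f (eC m (delta_mx 0 i : 'rV[base_alg k]_n)) +
  \sum_i pd y 0 i *: f (eD n (delta_mx 0 i : 'rV[base_alg k]_m)).

Lemma smod_sum_linear (V : lmodType R) (f : smod_space -> V) :
  linear (smod_sum f).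
Proof.
move=> a x y; rewrite /smod_sum !linE !scalerDr [RHS]addrACA; congr (_ + _);
  last first.
  rewrite scaler_sumr -big_split; apply: eq_bigr => i _ /=.
  by rewrite !mxE scalerDl scalerA.
rewrite [RHS]addrACA; congr (_ + _); last first.
  rewrite scaler_sumr -big_split; apply: eq_bigr => i _ /=.
  by rewrite !mxE scalerDl scalerA.
rewrite [RHS]addrACA; congr (_ + _); last first.
  rewrite scaler_sumr -big_split; apply: eq_bigr => i _ /=.
  by rewrite !mxE scalerDl scalerA.
by rewrite [RHS]addrACA !scalerDl !scalerA.
Qed.

Lemma smod_sum_comp (V W : lmodType R) (g : {linear V -> W})
    (f : smod_space -> V) (f' : smod_space -> W) :
  (forall v, g (f v) = f' v) -> forall y, g (smod_sum f y) = smod_sum f' y.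
Proof.
move=> gf y; have gs p (c : 'I_p -> R) (F : 'I_p -> smod_space) :
    g (\sum_i c i *: f (F i)) = \sum_i c i *: f' (F i).
  by rewrite linear_sum; apply: eq_bigr => i _; rewrite linearZ /= gf.
by rewrite /smod_sum !linearD !gs !linearZ /= !gf.
Qed.

Definition smod_in (v : smod_space) : srt R :=
  smod_map (structure_hom R) (v : srt (base_alg k)).

Lemma smod_in_parts a b w c d : smod_in (@mk k n m (base_alg k) a b w c d) =
  let t := structure_hom R in mk (t a) (t b) (map_mx t w) (map_mx t c) (map_mx
    t d).
Proof. by apply: smod_eq; rewrite mapE !mkE. Qed.

Lemma smod_sum_in y : smod_sum smod_in y = y.
Proof.
rewrite /smod_sum /eE /eU /eW /eC /eD.
under eq_bigr => i _ do rewrite smod_in_parts /= !rmorph0 !map_mx0 map_delta_mx.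
under [X in _ + X + _]eq_bigr =>
  i _ do rewrite smod_in_parts /= !rmorph0 !map_mx0 map_delta_mx.
under [X in _ + X]eq_bigr =>
  i _ do rewrite smod_in_parts /= !rmorph0 !map_mx0 map_delta_mx.
rewrite !smod_in_parts /= !rmorph0 !rmorph1 !map_mx0.
rewrite -(linear_fun_sum (@eW_linear _ _ _ _)) -(linear_fun_sum (@eC_linear _ _
  _ _)).
rewrite -(linear_fun_sum (@eD_linear _ _ _ _)) -!row_sum_delta.
by rewrite [RHS]smod_decomp -[pu y in RHS]mulr1 eU_scale.
Qed.

Lemma smod_inD : {morph smod_in : u v / u + v}.
Proof.
move=> u v; have := smod_map_lin (structure_hom R) 1 (u : srt (base_alg k)) v.
by rewrite rmorph1 !scale1r.
Qed.

Lemma smod_inZ c v : smod_in (c *: v) = ca_in R c *: smod_in v.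
Proof.
have in0 : smod_in 0 = 0 by apply: (addrI (smod_in 0));
  rewrite -smod_inD !addr0.
have := smod_map_lin (structure_hom R) c (v : srt (base_alg k)) 0.
by rewrite !addr0 -[smod_map _ 0]/(smod_in 0) in0 addr0.
Qed.

Lemma smod_in_mul u v : smod_in (fda_mul A u v) = mul R (smod_in u) (smod_in v).
Proof. exact: smod_map_amul. Qed.

End Expand.

Lemma smod_in_base v : smod_in (base_alg k) v = v.
Proof. by apply: smod_eq; rewrite mapE ?map_mx_id. Qed.

Section Iso.
Variable R : comAlg k.
Local Notation bcin := (@bc_in k A R).

Lemma smod_sum_bc_in v : smod_sum bcin (smod_in R v) = bcin v.
Proof.
rewrite -{2}[v]smod_in_base -[smod_in _ v in RHS]smod_sum_in /smod_sum.
rewrite !bc_inD !bc_in_sum !bc_inZ !smod_in_base.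
congr (_ + _ + _ + _ + _); apply: eq_bigr => i _.
- by rewrite bc_inZ smod_in_base mxE.
- by rewrite bc_inZ smod_in_base mxE.
- by rewrite bc_inZ smod_in_base mxE.
Qed.

Definition of_smod : {linear srt R -> bc A R} :=
  HB.pack (smod_sum bcin)
    (GRing.isLinear.Build _ _ _ *:%R _ (smod_sum_linear bcin)).

(** [bc A R] uses coordinates in the basis [vbasis], not in the summands of the algebra; the
    universal property supplies the comparison without relating the two bases. *)
Definition to_smod : {linear bc A R -> srt R} :=
  sval (cid (@bc_univ k A R _ _ (@smod_inD R) (@smod_inZ R))).

Lemma to_smod_in v : to_smod (bcin v) = smod_in R v.
Proof. by rewrite /to_smod; case: cid => g [/= ->]. Qed.

Lemma of_smod_in v : of_smod (smod_in R v) = bcin v.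
Proof. exact: smod_sum_bc_in. Qed.

Lemma to_smodK : cancel to_smod of_smod.
Proof.
apply: (bc_ext (g := of_smod \o to_smod) (h := idfun)) => v /=.
by rewrite to_smod_in -[LHS]/(of_smod (smod_in R v)) of_smod_in.
Qed.

Lemma of_smodK : cancel of_smod to_smod.
Proof.
move=> y; rewrite -[of_smod y]/(smod_sum bcin y).
by rewrite (smod_sum_comp to_smod_in) smod_sum_in.
Qed.

Lemma to_smod_mul x y : to_smod (bc_mul x y) = mul R (to_smod x) (to_smod y).
Proof.
have expand z : to_smod z = \sum_i z 0 i *: smod_in R (@bc_basis k A i).
  rewrite {1}[z]bc_expand linear_sum; apply: eq_bigr => i _.
  by rewrite linearZ /= to_smod_in.
rewrite (expand x) (linear_fun_sum (amul_linearl _ _ _ _ _ _ _ _)).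
rewrite /bc_mul linear_sum; apply: eq_bigr => i _.
rewrite (expand y) (linear_fun_sum (amul_linearr _ _ _ _ _ _ _ _)).
rewrite linear_sum scaler_sumr; apply: eq_bigr => j _.
by rewrite linearZ /= to_smod_in -smod_in_mul scalerA.
Qed.

Lemma of_smod_mul x y : of_smod (mul R x y) = bc_mul (of_smod x) (of_smod y).
Proof. by rewrite -[RHS]to_smodK to_smod_mul !of_smodK. Qed.

Definition blk_lin (P : 'M[R]_n) (Q : 'M[R]_m) : {linear srt R -> srt R} :=
  HB.pack (@blk k n m R P Q) (GRing.isLinear.Build _ _ _
    *:%R _ (@blk_linear k n m R P Q)).

End Iso.
Arguments of_smod {R}.
Arguments to_smod {R}.

Lemma of_smod_map (R S : comAlg k) (t : algHom R S) (y : srt R) :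
  map_mx t (of_smod y) = of_smod (smod_map t y).
Proof.
rewrite -[of_smod y]/(smod_sum (@bc_in k A R) y).
rewrite -[of_smod _]/(smod_sum (@bc_in k A S) (smod_map t y)) /smod_sum !mapE.
rewrite !map_mxD !map_mxZ !(@map_bc_in k A R S t).
congr (_ + _ + _ + _ + _); rewrite raddf_sum; apply: eq_bigr => i _.
- by rewrite /= map_mxZ (@map_bc_in k A R S t) mxE.
- by rewrite /= map_mxZ (@map_bc_in k A R S t) mxE.
- by rewrite /= map_mxZ (@map_bc_in k A R S t) mxE.
Qed.

Variable G : groupFunctor k.
Variables (MR : forall R : comAlg k, G R -> 'M[R]_n)
  (QR : forall R : comAlg k, G R -> 'M[R]_m).
Hypothesis MR_mul : forall R (x y : G R), MR (x * y)%g = MR y *m MR x.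
Hypothesis QR_mul : forall R (x y : G R), QR (x * y)%g = QR y *m QR x.
Hypothesis MR_one : forall R, MR (1%g : G R) = 1%:M.
Hypothesis QR_one : forall R, QR (1%g : G R) = 1%:M.
Hypothesis MR_map : forall R S (t : algHom R S) (x : G R),
  MR (gf_map t x) = map_mx t (MR x).
Hypothesis QR_map : forall R S (t : algHom R S) (x : G R),
  QR (gf_map t x) = map_mx t (QR x).
Hypothesis MR_inj : forall R, injective (@MR R).
Hypothesis compatP : forall (R : comAlg k) (P : 'M[R]_n) (Q : 'M[R]_m),
  compatible L T o P Q <-> exists2 x : G R, P = MR x & Q = QR x.
Hypothesis eigs : uniq [:: 0; 1; al; be; ga; de].

(** * The automorphism attached to a point, and its inverse construction *)

Section Point.
Variables (R : comAlg k) (x : G R).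

Definition point_lin : {linear bc A R -> bc A R} :=
  (@of_smod R \o blk_lin (MR x) (QR x)) \o @to_smod R.

Lemma blk_can (y : G R) :
  cancel (blk (MR y) (QR y)) (blk (MR y^-1%g) (QR y^-1%g)).
Proof.
move=> z; apply: smod_eq; rewrite !blkE //.
  by rewrite -mulmxA -MR_mul mulVg MR_one mulmx1.
by rewrite -mulmxA -QR_mul mulVg QR_one mulmx1.
Qed.

Lemma point_bij : bijective point_lin.
Proof.
apply: bij_comp; last by exists (@of_smod R); [apply: to_smodK|apply: of_smodK].
apply: bij_comp; first by exists (@to_smod R);
  [apply: of_smodK|apply: to_smodK].
exists (blk (MR x^-1%g) (QR x^-1%g)); first exact: blk_can.
by have := blk_can x^-1%g; rewrite invgK.
Qed.

Lemma point_mul : {morph point_lin : y z / bc_mul y z}.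
Proof.
have [_ PQ] := compatP (MR x) (QR x).
move=> y z; rewrite /point_lin /= to_smod_mul -of_smod_mul; congr (of_smod _).
by rewrite -[LHS]/(blk _ _ _) blk_amul //; apply: PQ; exists x.
Qed.

Definition point_aut : algAut A R := AlgAut point_bij point_mul.

End Point.

Lemma point_autM (R : comAlg k) : {morph @point_aut R : x y / (x * y)%g}.
Proof.
move=> x y; apply: algAutP => z.
rewrite -[LHS]/(of_smod (blk _ _ (to_smod z))).
rewrite -[RHS]/(of_smod (blk _ _ (to_smod (of_smod (blk _ _ (to_smod z)))))).
rewrite of_smodK; congr (of_smod _).
by apply: smod_eq; rewrite !blkE // ?MR_mul ?QR_mul mulmxA.
Qed.

Lemma point_aut_map (R S : comAlg k) (t : algHom R S) (x : G R) :
  point_aut (gf_map t x) = aut_map t (point_aut x).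
Proof.
apply: algAutP; apply: bc_ext => v; rewrite [RHS]aut_map_fun_in.
rewrite -[LHS]/(of_smod (blk _ _ (to_smod _))).
rewrite -[point_aut x _]/(of_smod (blk _ _ (to_smod _))).
rewrite of_smod_map smod_map_blk !to_smod_in MR_map QR_map.
congr (of_smod (blk _ _ _)).
by apply: smod_eq; rewrite !mapE ?map_mx_comp_in ?ah_in.
Qed.

(** An automorphism of the base change becomes block diagonal on [smod] by [smod_automorphism], and
    [compatP] names the point it comes from. Injectivity reads [MR x] off the action on C. *)
Lemma point_aut_bij (R : comAlg k) : bijective (@point_aut R).
Proof.
have inj : injective (@point_aut R).
  move=> x y xy; apply: MR_inj; apply: row_mulmx_inj => c.
  have /(congr1 (fun z => pc (to_smod z))) :
      point_aut x (of_smod (eC m c)) =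
        point_aut y (of_smod (eC m c)) by rewrite xy.
  rewrite -[point_aut x _]/(of_smod (blk _ _ (to_smod _))).
  rewrite -[point_aut y _]/(of_smod (blk _ _ (to_smod _))).
  by rewrite !of_smodK !blkE.
have surj (g : algAut A R) : exists x, point_aut x = g.
  pose h : {linear srt R -> srt R} := (@to_smod R \o g) \o @of_smod R.
  have h_bij : bijective h.
    apply: bij_comp; last by exists (@to_smod R);
      [apply: of_smodK|apply: to_smodK].
    apply: bij_comp; last exact: aut_bij.
    by exists (@of_smod R); [apply: to_smodK|apply: of_smodK].
  have hM : {morph h : y z / mul R y z}.
    move=> y z; rewrite -[LHS]/(to_smod (g (of_smod (mul R y z)))).
    by rewrite of_smod_mul autM to_smod_mul.
  have [P [Q [/compatP [x -> ->] hE]]] := smod_automorphism eigs h_bij hM.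
  exists x; apply: algAutP => y.
  rewrite -[LHS]/(of_smod (blk _ _ (to_smod y))) -hE.
  by rewrite -[h _]/(to_smod (g (of_smod (to_smod y)))) !to_smodK.
pose f g := sval (cid (surj g)).
have fK g : point_aut (f g) = g := svalP (cid (surj g)).
by exists f => // x; apply: inj.
Qed.

Lemma recognition : gf_isomorphic G (Aut_functor A).
Proof.
exists (@point_aut); split;
  [exact: point_aut_bij|exact: point_autM|exact: point_aut_map].
Qed.

End Recognition.

(** * The theorem *)

Lemma four_eigenvalues (k : fieldType) :
  (exists s : seq k, uniq s /\ (8 <= size s)%N) ->
  exists al be ga de : k, uniq [:: 0; 1; al; be; ga; de].
Proof.
move=> [s [us s8]]; pose s' := [seq x <- s | x \notin [:: 0; 1]].
have s'6 : (6 <= size s')%N.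
  have := count_predC (mem [:: 0 : k; 1]) s;
    rewrite -(size_filter (predC _)) => e.
  have c2 : (count (mem [:: 0%R : k; 1%R]) s <= 2)%N.
    rewrite -size_filter; apply: (@uniq_leq_size _ _ [:: 0; 1]);
      first exact: filter_uniq.
    by move=> x; rewrite mem_filter => /andP[].
  by rewrite -(leq_add2l 2) (leq_trans s8) // -e leq_add2r.
have : uniq (take 4 s') by rewrite take_uniq // filter_uniq.
have : {in take 4 s', forall x, x \notin [:: 0; 1]}.
  by move=> x /mem_take; rewrite mem_filter => /andP[].
have : size (take 4 s') = 4 by rewrite size_takel // (leq_trans _ s'6).
case: (take 4 s') => [|al [|be [|ga [|de [|//]]]]] // _ s01 us4.
exists al, be, ga, de;
  rewrite 2!cons_uniq us4 andbT inE negb_or eq_sym oner_eq0.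
by apply/andP; split; apply/negP => /s01; rewrite !inE eqxx ?orbT.
Qed.

Section Main.
Variables (k : fieldType) (G : groupFunctor k) (H : comAlg k) (u : G H).
Hypotheses (Hfg : finitely_generated H) (uP : represents u).
Variables (al be ga de : k).
Hypothesis eigs : uniq [:: 0; 1; al; be; ga; de].

Local Notation ev := (ev uP).

(** * Translations of C and D as the compatible pairs of matrices *)

Section Structure.
Variables (s : seq H) (b : dual_basis s) (b' : dual_basis (prods s s)).
Hypothesis s1 : 1 \in s.
Hypothesis s_gen : generates s.
Hypothesis s_ext : forall (R : comAlg k) (g g' : H -> R), klin g -> klin g' ->
  g 1 = 1 -> (forall x y, lspan s x -> lspan s y -> g x * g y = g' (x * y)) ->
  exists f : algHom H R, forall x, lspan s x -> f x = g x.

Let n := db_dim b.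
Let m := db_dim b'.
Let v := db_vec b.
Let v' := db_vec b'.
Variables (M : 'I_n -> 'I_n -> H) (Q : 'I_m -> 'I_m -> H).
Hypothesis MP : coaction (b := b) uP M.
Hypothesis QP : coaction (b := b') uP Q.
Hypothesis MV : forall j i, lspan s (M j i).

(** In the basis [v] this is the operator (l (x) id) Delta on C, with l the [i]-th coordinate form:
    it sends [v j] to [M j i], which lies in C by [MV]. *)
Let L (i : 'I_n) : 'M[k]_n := \matrix_(j, l) db_coord b l (M j i).
Let T (i : 'I_n) : 'M[k]_(n, m) := \matrix_(j, l) db_coord b' l (v i * v j).
Let o : 'rV[k]_n := \row_l db_coord b l 1.

Let MR (R : comAlg k) (x : G R) : 'M[R]_n := \matrix_(j, i) ev x (M j i).
Let QR (R : comAlg k) (x : G R) : 'M[R]_m := \matrix_(j, i) ev x (Q j i).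

Let MR_mul (R : comAlg k) (x y : G R) : MR (x * y)%g = MR y *m MR x.
Proof.
apply/matrixP => j i; rewrite !mxE (coactionM MP).
by apply: eq_bigr => l _; rewrite !mxE.
Qed.

Let QR_mul (R : comAlg k) (x y : G R) : QR (x * y)%g = QR y *m QR x.
Proof.
apply/matrixP => j i; rewrite !mxE (coactionM QP).
by apply: eq_bigr => l _; rewrite !mxE.
Qed.

Let MR_one (R : comAlg k) : MR (1%g : G R) = 1%:M.
Proof. by apply/matrixP => j i; rewrite !mxE (coaction1 MP). Qed.

Let QR_one (R : comAlg k) : QR (1%g : G R) = 1%:M.
Proof. by apply/matrixP => j i; rewrite !mxE (coaction1 QP). Qed.

Let MR_map (R S : comAlg k) (t : algHom R S) (x : G R) :
  MR (gf_map t x) = map_mx t (MR x).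
Proof. by apply/matrixP => j i; rewrite !mxE ev_map. Qed.

Let QR_map (R S : comAlg k) (t : algHom R S) (x : G R) :
  QR (gf_map t x) = map_mx t (QR x).
Proof. by apply/matrixP => j i; rewrite !mxE ev_map. Qed.

Let ev_span_inj (R : comAlg k) (x y : G R) :
  (forall j i, ev x (M j i) = ev y (M j i)) -> x = y.
Proof.
move=> e; apply: (ev_inj (uP := uP)).
apply: s_gen => [c|h hs|a c ea ec|a c ea ec].
- by rewrite !ah_in.
- apply: (db_ind (b := b) (P := fun h => ev x h = ev y h)) (lspan_mem hs).
    exact: subspace_eq (klin_alg _) (klin_alg _).
  move=> j; rewrite (coaction_counit MP j) !rmorph_sum; apply: eq_bigr => i _.
  by rewrite !rmorphM e !ah_in.
- by rewrite !rmorphD ea ec.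
- by rewrite !rmorphM ea ec.
Qed.

Let MR_inj (R : comAlg k) : injective (@MR R).
Proof.
move=> x y xy; apply: ev_span_inj => j i.
by have := congr1 (fun B : 'M_n => B j i) xy; rewrite !mxE.
Qed.

Let vv i j : lspan (prods s s) (v i * v j).
Proof.
apply: lspan_mul (db_span b i) (db_span b j) => a c as_ cs.
exact: lspan_mem (mem_prods as_ cs).
Qed.

Let prods_ind (P : H -> Prop) : subspace P -> (forall i j, P (v i * v j)) ->
  forall x, lspan (prods s s) x -> P x.
Proof.
move=> PS Pv; have [P0 PD PZ] := PS.
have sub (f : H -> H) : klin f -> subspace (fun x => P (f x)).
  move=> fL; split=> [|x y|c x]; first by rewrite klin0.
    by rewrite fL.1; apply: PD.
  by rewrite fL.2; apply: PZ.
have mulrL a : klin (fun x : H => a * x).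
  by split=> [x y|c x]; rewrite ?mulrDr // mulrCA.
move=> x; apply; first exact: PS.
move=> _ /allpairsP[[a c] /= [as_ cs ->]].
apply: (db_ind (b := b) (P := fun a => P (a * c))) (lspan_mem as_).
  exact: sub (klin_mulr c).
move=> i; apply: (db_ind (b := b) (P := fun c => P (v i * c))) (lspan_mem cs).
  exact: sub (mulrL _).
exact: Pv.
Qed.

Let mulC_basis (R : comAlg k) (P : 'M[R]_n) (B : 'M[R]_m) :
  (forall i j, mulC T (row i P) (row j P) =
    mulC T (delta_mx 0 i) (delta_mx 0 j) *m B) ->
  forall c c', mulC T (c *m P) (c' *m P) = mulC T c c' *m B.
Proof.
move=> h c c'.
have e (d : 'rV[R]_n) : d *m P = \sum_i d 0 i *: row i P.
  by rewrite [d in LHS]row_sum_delta mulmx_suml; apply: eq_bigr => i _;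
    rewrite -scalemxAl -rowE.
rewrite (e c) (linear_fun_sum (mulC_linearl _ _)) [c in RHS]row_sum_delta.
rewrite (linear_fun_sum (mulC_linearl _ _)) mulmx_suml; apply: eq_bigr => i _.
rewrite -scalemxAl; congr (_ *: _).
rewrite (e c') (linear_fun_sum (mulC_linearr _ _)) [c' in RHS]row_sum_delta.
rewrite (linear_fun_sum (mulC_linearr _ _)) mulmx_suml; apply: eq_bigr => j _.
by rewrite -scalemxAl h.
Qed.

Let mulC_rows (R : comAlg k) (P : 'M[R]_n) i j l :
  mulC T (row i P) (row j P) 0 l =
  \sum_a \sum_c P i a * P j c * ca_in R (db_coord b' l (v a * v c)).
Proof.
rewrite /mulC summxE; apply: eq_bigr => a _.
rewrite !mxE mulr_sumr; apply: eq_bigr => c _.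
by rewrite !mxE mulrA.
Qed.

Let mulC_delta_row (R : comAlg k) (B : 'M[R]_m) i j l :
  (mulC T (delta_mx 0 i) (delta_mx 0 j) *m B) 0 l =
  \sum_q ca_in R (db_coord b' q (v i * v j)) * B q l.
Proof.
rewrite mulC_delta -rowE mxE; apply: eq_bigr => q _.
by rewrite !mxE.
Qed.

Let expand_at (R : comAlg k) (z : G R) h : lspan s h ->
  ev z h = \sum_i ca_in R (db_coord b i h) * ev z (v i).
Proof.
move=> /(db_expand b) {1}->; rewrite rmorph_sum; apply: eq_bigr => i _.
by rewrite rmorphM ah_in.
Qed.

Let expand_at' (R : comAlg k) (z : G R) h : lspan (prods s s) h ->
  ev z h = \sum_i ca_in R (db_coord b' i h) * ev z (v' i).
Proof.
move=> /(db_expand b') {1}->; rewrite rmorph_sum; apply: eq_bigr => i _.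
by rewrite rmorphM ah_in.
Qed.

(** The three conditions express coassociativity, multiplicativity of translation, and invariance of
    the constant function 1. Each is read off by expanding a function at z x in two ways. *)
Let point_compatible (R : comAlg k) (x : G R) : compatible L T o (MR x) (QR x).
Proof.
split.
- move=> i; apply/matrixP => j a; rewrite !mxE.
  under eq_bigr => l _ do rewrite !mxE.
  under [RHS]eq_bigr => l _ do rewrite !mxE.
  apply: (coaction_coords MP (MV j i)
    (r := fun a => \sum_l ev x (M j l) * ca_in R (db_coord b a (M l i)))) =>
      S t z.
  rewrite (coactionM MP).
  under eq_bigr => l _ do rewrite (expand_at z (MV l i)) mulr_sumr.
  rewrite exchange_big; apply: eq_bigr => a' _.
  rewrite rmorph_sum mulr_sumr; apply: eq_bigr => l _.
  by rewrite rmorphM ah_in ev_map mulrA mulrC.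
- apply: mulC_basis => i j; apply/rowP => l; rewrite mulC_rows mulC_delta_row.
  under [RHS]eq_bigr => q _ do rewrite mxE.
  apply/esym; apply: (coaction_coords QP (vv i j) (r := fun l => \sum_a \sum_c
    MR x i a * MR x j c * ca_in R (db_coord b' l (v a * v c)))) => S t z.
  rewrite rmorphM !MP mulr_suml.
  under eq_bigr => a _.
    rewrite mulr_sumr.
    under eq_bigr =>
      c _ do rewrite mulrACA -(rmorphM (ev z)) (expand_at' z (vv a c))
      mulr_sumr.
    over.
  under eq_bigr => a _ do rewrite exchange_big.
  rewrite exchange_big; apply: eq_bigr => q _.
  rewrite rmorph_sum mulr_sumr; apply: eq_bigr => a _.
  rewrite rmorph_sum mulr_sumr; apply: eq_bigr => c _.
  by rewrite !mxE !rmorphM !ev_map ah_in [LHS]mulrA [LHS]mulrC.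
- apply/rowP => a; rewrite !mxE.
  under eq_bigr => l _ do rewrite !mxE.
  apply: (coaction_coords MP (lspan_mem s1)
    (r := fun a => ca_in R (db_coord b a 1))) => S t z.
  rewrite rmorph1 -[LHS](rmorph1 (ev z)) (expand_at z (lspan_mem s1)).
  by apply: eq_bigr => i _; rewrite ah_in mulrC.
Qed.

(** The counit after [P] is a truncated homomorphism, which [s_ext] extends to [H]; commutation with
    the [L i] identifies [P] with translation by the resulting point. *)
Let compatible_point (R : comAlg k) (P : 'M[R]_n) (B : 'M[R]_m) :
  compatible L T o P B -> exists2 x : G R, P = MR x & B = QR x.
Proof.
move=> [PL PB Po].
pose eta i : R := ca_in R (counit uP (v i)).
pose eta' i : R := ca_in R (counit uP (v' i)).
have etaE h : lspan s h ->
    \sum_i ca_in R (db_coord b i h) * eta i = ca_in R (counit uP h).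
  move=> hs; rewrite -ev1 (expand_at _ hs); apply: eq_bigr => i _.
  by rewrite ev1.
have etaE' h : lspan (prods s s) h ->
    \sum_i ca_in R (db_coord b' i h) * eta' i = ca_in R (counit uP h).
  move=> hs; rewrite -ev1 (expand_at' _ hs); apply: eq_bigr => i _.
  by rewrite ev1.
pose gam j := \sum_i P j i * eta i.
pose gam' j := \sum_i B j i * eta' i.
pose g h := \sum_j ca_in R (db_coord b j h) * gam j.
pose g' h := \sum_j ca_in R (db_coord b' j h) * gam' j.
have gL : klin g by apply: klin_comb; apply: db_lin.
have g'L : klin g' by apply: klin_comb; apply: db_lin.
have gv i : g (v i) = gam i.
  rewrite /g (bigD1 i) //= db_dual eqxx rmorph1 mul1r big1 ?addr0 // => j ji.
  by rewrite db_dual (negPf ji) rmorph0 mul0r.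
(* Since [M j i] is the image of [v j] under [L i], this operator can be moved past [P]; what
   remains is the counit of the [M l i], a Kronecker delta. *)
have gM j i : g (M j i) = P j i.
  have /matrixP/(_ j) PLj := PL i.
  transitivity (\sum_a (map_mx (ca_in R) (L i) *m P) j a * eta a).
    rewrite /g; under eq_bigr => l _ do rewrite /gam mulr_sumr.
    rewrite exchange_big; apply: eq_bigr => a _; rewrite mxE mulr_suml.
    by apply: eq_bigr => l _; rewrite !mxE mulrA.
  under eq_bigr => a _ do rewrite PLj mxE mulr_suml.
  rewrite exchange_big /=.
  transitivity (\sum_l P j l * (l == i)%:R).
    apply: eq_bigr => l _.
    have := etaE _ (MV l i); rewrite -ev1 (coaction1 MP) => <-.
    by rewrite mulr_sumr; apply: eq_bigr => a _; rewrite !mxE mulrA.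
  rewrite (bigD1 i) //= eqxx mulr1 big1 ?addr0 // => l li.
  by rewrite (negPf li) mulr0.
have gvv i j : gam i * gam j = g' (v i * v j).
  have := PB (delta_mx 0 i) (delta_mx 0 j); rewrite -!rowE => e.
  transitivity (\sum_l mulC T (row i P) (row j P) 0 l * eta' l).
    rewrite /gam mulr_suml.
    under [RHS]eq_bigr => l _ do rewrite mulC_rows mulr_suml.
    rewrite [RHS]exchange_big; apply: eq_bigr => a _; rewrite mulr_sumr.
    under [RHS]eq_bigr => l _ do rewrite mulr_suml.
    rewrite [RHS]exchange_big; apply: eq_bigr => c _ /=.
    under [RHS]eq_bigr => l _ do rewrite -mulrA.
    rewrite -mulr_sumr (etaE' _ (vv a c)) -ev1 rmorphM !ev1.
    by rewrite mulrACA.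
  rewrite e; under eq_bigr => l _ do rewrite mulC_delta_row mulr_suml.
  rewrite exchange_big; apply: eq_bigr => q _; rewrite /gam' mulr_sumr.
  by apply: eq_bigr => l _; rewrite mulrA.
have g1 : g 1 = 1.
  have := etaE 1 (lspan_mem s1); rewrite -ev1 rmorph1 => <-.
  rewrite /g; under eq_bigr => l _ do rewrite /gam mulr_sumr.
  rewrite exchange_big; apply: eq_bigr => a _ /=.
  have := congr1 (fun r : 'rV_n => r 0 a) Po; rewrite !mxE => <-.
  by rewrite mulr_suml; apply: eq_bigr => l _; rewrite !mxE mulrA.
have gmul x y : lspan s x -> lspan s y -> g x * g y = g' (x * y).
  move=> xs ys.
  have mulrL (K : comAlg k) (a : K) : klin (fun x : K => a * x).
    by split=> [z w|c z]; rewrite ?mulrDr // mulrCA.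
  apply: (db_ind (b := b) (P := fun x => g x * g y = g' (x * y))) xs.
    exact: subspace_eq (klin_comp (klin_mulr _) gL) (klin_comp g'L
      (klin_mulr _)).
  move=> i; apply: (db_ind (b := b) (P := fun y => g (v i) * g y =
    g' (v i * y))) ys.
    exact: subspace_eq (klin_comp (mulrL _ _) gL) (klin_comp g'L (mulrL _ _)).
  by move=> j; rewrite !gv gvv.
have [f fg] := s_ext gL g'L g1 gmul.
have fM : P = MR (gf_map f u).
  by apply/matrixP => j i; rewrite mxE ev_of fg // gM.
exists (gf_map f u) => //.
(* [B] is forced by [P]: it and the translation matrix of the point agree on the products
   [v i * v j], which span D. *)
have [_ xB _] := point_compatible (gf_map f u).
apply/matrixP => q l.
pose h (B0 : 'M[R]_m) y := \sum_a ca_in R (db_coord b' a y) * B0 a l.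
have hL B0 : klin (h B0) by apply: klin_comb; apply: db_lin.
have hv B0 : h B0 (v' q) = B0 q l.
  rewrite /h (bigD1 q) //= db_dual eqxx rmorph1 mul1r big1 ?addr0 // => j ji.
  by rewrite db_dual (negPf ji) rmorph0 mul0r.
rewrite -hv -[RHS]hv; apply: (prods_ind (P := fun y => h B y = h _ y))
  (db_span b' q).
  exact: subspace_eq (hL _) (hL _).
by move=> i j; rewrite /h -!mulC_delta_row -PB -xB fM.
Qed.

Lemma structure_recognition :
  exists A : fdAlgebra k, gf_isomorphic G (Aut_functor A).
Proof.
exists (smod_fda al be ga de L T o).
apply: (recognition MR_mul QR_mul MR_one QR_one MR_map QR_map MR_inj _ eigs).
move=> R P B; split; first exact: compatible_point.
by move=> [x -> ->]; apply: point_compatible.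
Qed.

End Structure.

Lemma representable_recognition :
  exists A : fdAlgebra k, gf_isomorphic G (Aut_functor A).
Proof.
have [s [ss s1 sg sx]] := quadratic_subcoalgebra uP Hfg.
have [b] := dual_basis_exists s; have [b'] := dual_basis_exists (prods s s).
have [M MP MV] := coaction_exists b (lspan_subspace s) ss.
have [||Q QP _] := @coaction_exists _ _ _ _ uP _ b' (fun=> True).
- by [].
- move=> _ /allpairsP[[x y] /= [/ss xs /ss ys ->]].
  exact: splits_mono (splitsM xs ys).
exact: (@structure_recognition s b b' s1 sg sx M Q MP QP MV).
Qed.

End Main.

Theorem theorem1 (k : fieldType)
    (k_ge8 : exists s : seq k, uniq s /\ (8 <= size s)%N)
    (G : algebraicGroup k) :
  exists A : fdAlgebra k, gf_isomorphic G (Aut_functor A).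
Proof.
have [al [be [ga [de eigs]]]] := four_eigenvalues k_ge8.
have [H [u [Hfg uP]]] := ag_representable G.
exact: (@representable_recognition k G H u Hfg uP al be ga de eigs).
Qed.
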